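(* Let $A,B$ be commuting $n\times n$ nilpotent matrices over a field $K$, with $B$ in Jordan form of partition $P$, and suppose $\dim_K K[A,B]=n$. Let $H=H(K[A,B])$ be the Hilbert function, of socle degree $j$. Let $K$ be algebraically closed of characteristic zero, or of characteristic $p>j$. Then for a generic $\lambda\in\mathbb P^1$, the Jordan block sizes of the action of $A+\lambda B$ both on $K[A,B]$ and on the associated graded algebra $\mathrm{Gr}_{\mathfrak m}K[A,B]$ are given by the parts of $P(H)$. Moreover $P(H)\ge P$ in the majorization order.
   Context: $K[A,B]$ is the $K$-subalgebra of $M_n(K)$ generated by $A,B$ (and the identity), an Artinian local algebra with maximal ideal $\mathfrak m=(A,B)$; $\mathrm{Gr}_{\mathfrak m}K[A,B]=\bigoplus_i\mathfrak m^i/\mathfrak m^{i+1}$. Elements act by multiplication; on the associated graded algebra $A+\lambda B$ acts as multiplication by its class in $\mathfrak m/\mathfrak m^2$. The Hilbert function is $H=(h_0,\ldots,h_j)$, $h_i=\dim_K\mathfrak m^i/\mathfrak m^{i+1}$, where the socle degree $j$ is the largest $i$ with $h_i\neq0$. It has the form $(1,2,\ldots,\nu,h_\nu,\ldots,h_j)$ with $\nu\ge h_\nu\ge\cdots\ge h_j>0$. $P(H)$ is the partition dual to the partition obtained by rearranging $H$ in non-increasing order, i.e. its $i$-th part is $\#\{k\mid h_k\ge i\}$, $1\le i\le\nu$. $P$ is the partition of $n$ given by the Jordan block sizes of $B$. ''Generic $\lambda$'' means all but finitely many $\lambda$. The majorization partial order on partitions of $n$ (padded by zeros): $P\ge P'$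 iff $\sum_{u\le i}p_u\ge\sum_{u\le i}p'_u$ for all $i$. *)

(* Defs.v *)
From HB Require Import structures.
From mathcomp Require Import all_boot all_order all_algebra all_field.

Set Implicit Arguments.
Unset Strict Implicit.
Unset Printing Implicit Defensive.

Import GRing.Theory.
Local Open Scope ring_scope.

Definition is_partition (n : nat) (P : seq nat) : bool :=
  [&& sorted geq P, 0%N \notin P & sumn P == n].

(** The [i]-th part (from [0]) is the number of entries of [s] that are
    [> i]; there are as many parts as the largest entry. *)
Definition dual_partition (s : seq nat) : seq nat :=
  mkseq (fun i => count (fun x => i < x)%N s) (\max_(x <- s) x).

(** [P >= Q]; [take] past the end of a list amounts to padding by zeros. *)
Definition majorizes (P Q : seq nat) : Prop :=
  forall i, (sumn (take i Q) <= sumn (take i P))%N.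

Definition jordan_block (K : fieldType) (d : nat) : 'M[K]_d :=
  \matrix_(i, k) (i.+1 == k :> nat)%:R.

Definition jordan_mx (K : fieldType) (P : seq nat) :
    'M[K]_(\sum_(i < size P) nth 0%N P i) :=
  \mxdiag_(i < size P) jordan_block K (nth 0%N P i).

Definition is_jordan_form (K : fieldType) (n : nat) (B : 'M[K]_n)
    (P : seq nat) : Prop :=
  exists e : (\sum_(i < size P) nth 0%N P i = n)%N,
    B = castmx (e, e) (jordan_mx K P).

(** The endomorphism [f] is nilpotent with Jordan block sizes the parts of
    [P]: its matrix (columns = images of the basis vectors) in some basis
    of [V] is [jordan_mx K P]. *)
Definition has_jordan_type (K : fieldType) (V : vectType K) (f : 'End(V))
    (P : seq nat) : Prop :=
  exists2 X : (\sum_(i < size P) nth 0%N P i).-tuple V,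
    basis_of fullv X &
    forall k, f (tnth X k) = \sum_i jordan_mx K P i k *: tnth X i.

(** [quotv U W], for [W <= U], is the space [U / W], realised on the
    complement [U :\: W] of [W] in [U]; [quot_class U W] is the
    canonical projection: on [U] it is onto with kernel [W], see
    [quot_reprK] and [quot_class_eq0]. *)

Section Quotient.
Variables (K : fieldType) (V : vectType K).
Implicit Types U W : {vspace V}.

Definition quotv U W : vectType K := subvs_of (U :\: W)%VS.

Definition quot_class U W (x : V) : quotv U W :=
  vsproj (U :\: W) (addv_pi1 U W x).
Definition quot_repr U W (q : quotv U W) : V := vsval q.

Lemma quot_class_is_linear U W : linear (quot_class U W).
Proof. by move=> a x y; rewrite /quot_class !linearP. Qed.
HB.instance Definition _ U W :=
  GRing.isLinear.Build K V (quotv U W) _ (quot_class U W)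
    (@quot_class_is_linear U W).

Lemma quot_repr_is_linear U W : linear (@quot_repr U W).
Proof. by move=> a x y; rewrite /quot_repr linearP. Qed.
HB.instance Definition _ U W :=
  GRing.isLinear.Build K (quotv U W) V _ (@quot_repr U W)
    (@quot_repr_is_linear U W).

Lemma quot_repr_mem U W (q : quotv U W) : quot_repr q \in U.
Proof. by rewrite (subvP (diffvSl U W)) ?subvsP. Qed.

Lemma addv_pi1_diff U W x : addv_pi1 U W x \in (U :\: W)%VS.
Proof. exact: memv_pi. Qed.

Lemma quot_reprK U W : cancel (@quot_repr U W) (quot_class U W).
Proof.
move=> q; apply: val_inj => /=.
rewrite /quot_class vsprojK ?addv_pi1_diff //.
rewrite /addv_pi1 daddv_pi_id ?subvsP //; exact: capv_diff.
Qed.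

Lemma quot_class_eq0 U W x : (W <= U)%VS -> x \in U ->
  (quot_class U W x == 0) = (x \in W).
Proof.
move=> sWU Ux; have UWx : x \in (U + W)%VS by rewrite (addv_idPl sWU).
have dx := addv_pi1_pi2 UWx.
apply/eqP/idP => [q0|Wx].
  have p0 : addv_pi1 U W x = 0.
    by rewrite -(vsprojK (addv_pi1_diff U W x)) -/(quot_class U W x) q0 linear0.
  by rewrite -dx p0 add0r memv_pi2.
have: addv_pi1 U W x \in ((U :\: W) :&: W)%VS.
  rewrite memv_cap addv_pi1_diff /=.
  by rewrite -(addrK (addv_pi2 U W x) (addv_pi1 U W x)) dx rpredB ?memv_pi2.
by rewrite capv_diff memv0 /quot_class => /eqP->; rewrite linear0.
Qed.

End Quotient.

Import VectorInternalTheory.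

Section DirectSum.
Variables (K : fieldType) (N : nat) (T : 'I_N -> vectType K).

Definition dsum := {dffun forall i : 'I_N, T i}.
HB.instance Definition _ := Choice.on dsum.
Implicit Types f g : dsum.

Definition dsum_of (F : forall i, T i) : dsum := finfun F.

Lemma dsum_ofE F i : dsum_of F i = F i.
Proof. by rewrite ffunE. Qed.

Lemma dsumP f g : (forall i, f i = g i) <-> f = g.
Proof. exact: ffunP. Qed.

Definition dsum_add f g := dsum_of (fun i => f i + g i).
Definition dsum_opp f := dsum_of (fun i => - f i).
Definition dsum_zero := dsum_of (fun i => 0).
Definition dsum_scale (a : K) f := dsum_of (fun i => a *: f i).

Lemma dsum_addA : associative dsum_add.
Proof. by move=> f g h; apply/dsumP=> i; rewrite !dsum_ofE addrA. Qed.
Lemma dsum_addC : commutative dsum_add.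
Proof. by move=> f g; apply/dsumP=> i; rewrite !dsum_ofE addrC. Qed.
Lemma dsum_add0 : left_id dsum_zero dsum_add.
Proof. by move=> f; apply/dsumP=> i; rewrite !dsum_ofE add0r. Qed.
Lemma dsum_addN : left_inverse dsum_zero dsum_opp dsum_add.
Proof. by move=> f; apply/dsumP=> i; rewrite !dsum_ofE addNr. Qed.
HB.instance Definition _ := GRing.isZmodule.Build dsum
  dsum_addA dsum_addC dsum_add0 dsum_addN.

Lemma dsum_scaleA a b f : dsum_scale a (dsum_scale b f) = dsum_scale (a * b) f.
Proof. by apply/dsumP=> i; rewrite !dsum_ofE scalerA. Qed.
Lemma dsum_scale1 : left_id 1 dsum_scale.
Proof. by move=> f; apply/dsumP=> i; rewrite !dsum_ofE scale1r. Qed.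
Lemma dsum_scaleDr : right_distributive dsum_scale +%R.
Proof. by move=> a f g; apply/dsumP=> i; rewrite !dsum_ofE scalerDr. Qed.
Lemma dsum_scaleDl f : {morph dsum_scale^~ f : a b / a + b}.
Proof. by move=> a b; apply/dsumP=> i; rewrite !dsum_ofE scalerDl. Qed.
HB.instance Definition _ := GRing.Zmodule_isLmodule.Build K dsum
  dsum_scaleA dsum_scale1 dsum_scaleDr dsum_scaleDl.

Lemma dsumD f g i : (f + g) i = f i + g i.
Proof. exact: dsum_ofE. Qed.
Lemma dsumZ a f i : (a *: f) i = a *: f i.
Proof. exact: dsum_ofE. Qed.

Lemma dsum_vect_iso : Vector.axiom (\sum_i dim (T i)) dsum.
Proof.
exists (fun f : dsum => \mxrow_i v2r (f i)).
  move=> a f g; apply/mxrowP => i.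
  have subZ (M : 'rV[K]_(\sum_i dim (T i))) :
      submxrow (a *: M) i = a *: submxrow M i.
    by apply/rowP => k; rewrite !mxE.
  by rewrite submxrowD subZ !mxrowK dsumD dsumZ linearP.
exists (fun r => dsum_of (fun i => r2v (submxrow r i))) => [f|r].
  by apply/dsumP => i; rewrite dsum_ofE mxrowK v2rK.
by apply/mxrowP => i; rewrite mxrowK dsum_ofE r2vK.
Qed.
HB.instance Definition _ := Lmodule_hasFinDim.Build K dsum dsum_vect_iso.

End DirectSum.

Section AssociatedGraded.
Variables (K : fieldType) (L : falgType K).
Implicit Types (m : {vspace L}) (x y : L).

(** The factor [{:L}] only matters for [i = 0]: [m ^+ 0] is the line
    [K . 1], whereas the zeroth power of an ideal is the whole ring. *)
Definition ideal_pow m (i : nat) : {vspace L} := (m ^+ i * {:L})%VS.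

Definition gr_piece m (i : nat) : vectType K :=
  quotv (ideal_pow m i) (ideal_pow m i.+1).

Definition gr_class m (i : nat) : L -> gr_piece m i :=
  quot_class (ideal_pow m i) (ideal_pow m i.+1).

Definition gr_repr m (i : nat) : gr_piece m i -> L :=
  @quot_repr K L (ideal_pow m i) (ideal_pow m i.+1).

Definition hilbert m (i : nat) : nat := \dim {: gr_piece m i}.

Definition is_socle_degree m (j : nat) : Prop :=
  hilbert m j != 0%N /\ forall i, (j < i)%N -> hilbert m i = 0%N.

Definition hilbert_seq m (j : nat) : seq nat := mkseq (hilbert m) j.+1.

Definition hilbert_partition m (j : nat) : seq nat :=
  dual_partition (sort geq (hilbert_seq m j)).

(** The degrees [> j] are omitted; they vanish when [j] is the socle
    degree. *)
Definition gr m (j : nat) := dsum (fun i : 'I_j.+1 => gr_piece m i).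
HB.instance Definition _ m j := Vector.on (gr m j).

(** Products of homogeneous elements are
    [gr_class a x * gr_class b y = gr_class (a + b) (x * y)]:
    see [gr_class_mul]. *)
Definition gr_mul m j (u v : gr m j) : gr m j :=
  dsum_of (fun k : 'I_j.+1 =>
    \sum_(i < j.+1) \sum_(l < j.+1 | (i + l == k)%N)
      gr_class m k (gr_repr (u i) * gr_repr (v l))).

Lemma gr_mul_is_linear m j (u : gr m j) : linear (gr_mul u).
Proof.
move=> a v w; apply/dsumP => k.
rewrite dsumD dsumZ !dsum_ofE scaler_sumr -big_split; apply: eq_bigr => i _.
rewrite /= scaler_sumr -big_split; apply: eq_bigr => l _.
by rewrite dsumD dsumZ /gr_repr /gr_class linearP mulrDr -scalerAr linearP.
Qed.
HB.instance Definition _ m j (u : gr m j) :=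
  GRing.isLinear.Build K (gr m j) (gr m j) _ (gr_mul u)
    (@gr_mul_is_linear m j u).

Definition gr_amull m j (u : gr m j) : 'End(gr m j) := linfun (gr_mul u).

(** The class of [x] in [m / m^2], as an element of degree 1. *)
Definition gr_deg1 m j x : gr m j :=
  dsum_of (fun i : 'I_j.+1 => if i == 1%N :> nat then gr_class m i x else 0).

Lemma ideal_powS m i : (ideal_pow m i.+1 <= ideal_pow m i)%VS.
Proof. by rewrite /ideal_pow expvSr -prodvA prodvSr ?subvf. Qed.

Lemma ideal_powM m a b : ({:L} * m <= m)%VS ->
  (ideal_pow m a * ideal_pow m b <= ideal_pow m (a + b))%VS.
Proof.
move=> idm; rewrite /ideal_pow expvD -!prodvA prodvSr //.
case: b => [|b]; first by rewrite expv0 !prod1v subvf.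
by rewrite !prodvA prodvSl // expvSl prodvA prodvSl.
Qed.

Lemma gr_class_mul m a b x y : ({:L} * m <= m)%VS ->
    x \in ideal_pow m a -> y \in ideal_pow m b ->
  gr_class m (a + b)
    (gr_repr (gr_class m a x) * gr_repr (gr_class m b y)) =
  gr_class m (a + b) (x * y).
Proof.
move=> idm mx my.
have inK c z : z \in ideal_pow m c ->
    z - gr_repr (gr_class m c z) \in ideal_pow m c.+1.
  move=> mz; rewrite -(quot_class_eq0 (ideal_powS m c)).
    by rewrite linearB /= /gr_repr (quot_reprK (gr_class m c z)) subrr.
  by rewrite rpredB ?quot_repr_mem.
apply/eqP; rewrite eq_sym -subr_eq0 -linearB /=.
set x' := gr_repr _; set y' := gr_repr _.
have -> : x * y - x' * y' = (x - x') * y + x' * (y - y').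
  by rewrite mulrBl mulrBr addrA subrK.
have x'P : x' \in ideal_pow m a by exact: quot_repr_mem.
have H : (x - x') * y + x' * (y - y') \in ideal_pow m (a + b).+1.
  rewrite rpredD //.
    by rewrite -addSn (subvP (ideal_powM _ _ idm)) ?memv_mul ?inK.
  by rewrite -addnS (subvP (ideal_powM _ _ idm)) ?memv_mul ?inK.
by rewrite quot_class_eq0 ?ideal_powS // (subvP (ideal_powS _ _)).
Qed.

End AssociatedGraded.

Section PairAlgebra.
Variables (K : fieldType) (n : nat) (A B : 'M[K]_n.+1).

Definition pair_aspace : {aspace 'M[K]_n.+1} := <<1 & [:: A; B]>>%AS.

Definition pair_alg : falgType K := subvs_of pair_aspace.

(** Only meaningful when [M] lies in [pair_aspace]: see [pair_aspaceP]. *)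
Definition in_pair_alg (M : 'M[K]_n.+1) : pair_alg := vsproj pair_aspace M.

Definition max_ideal : {vspace pair_alg} :=
  ({:pair_alg} * <<[:: in_pair_alg A; in_pair_alg B]>>)%VS.

(** [A + l B] for [l] in the projective line, [None] being the point at
    infinity. *)
Definition pencil (l : option K) : pair_alg :=
  in_pair_alg (if l is Some c then A + c *: B else B).

Lemma pair_aspaceP M : M \in pair_aspace -> vsval (in_pair_alg M) = M.
Proof. exact: vsprojK. Qed.

Lemma mem_pencil l :
  (if l is Some c then A + c *: B else B) \in pair_aspace.
Proof.
have sub : (<<[:: A; B]>> <= pair_aspace)%VS.
  by apply: subv_trans (sub_agenv _); rewrite addvSr.
have AP : A \in pair_aspace by rewrite (subvP sub) ?memv_span ?inE ?eqxx.
have BP : B \in pair_aspace by rewrite (subvP sub) ?memv_span ?inE ?eqxx ?orbT.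
by case: l => [c|] //; rewrite rpredD ?rpredZ.
Qed.

Lemma max_ideal_left : ({:pair_alg} * max_ideal <= max_ideal)%VS.
Proof. by rewrite /max_ideal prodvA prodvSl ?subvf. Qed.

End PairAlgebra.

(* Main.v *)
From HB Require Import structures.
Require Import Defs.
From mathcomp Require Import all_boot all_order all_algebra all_field.
From mathcomp Require Import zify.

(** Let L = K[A,B] with generators a, b and maximal ideal m, and put
    F_d = m^d, h_d = dim F_d / F_{d+1}.  Everything is read off ranks of
    powers: for a partition P let [excess k P] be the sum of the truncated
    differences p - k over the parts p of P.  This is the rank of the k-th
    power of a nilpotent map with block sizes P; the family of these numbers
    determines the block sizes ([has_jordan_type_of_ranks]), and inequalities
    between them for all k give majorization ([majorizes_excess]).

    Upper bound.  Every c in m maps F_i into F_{i+1}, so for each i the rank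
    of c^k on L is at most dim L / F_i + dim F_{i+k}.  The superlevel set
    {d | h_d > t}, if nonempty, is an interval starting at t, and its length
    is a part of P(H); a good choice of i therefore turns the bound into
    [excess k P(H)] ([excess_dual_ge], [rank_pow_le]).

    Lower bound.  For all but finitely many lam, with l = a + lam b, the map
    induced by l^k from F_i to F_{i+k} / F_{i+k+1} has rank at least
    min (h_{i+k}, i+1) ([generic_lefschetz]), and these minima add up to at
    least [excess k P(H)] ([excess_dual_le]).  Indeed, for d = i + k, the class of
    (a + lam b)^d is a polynomial curve of degree d in lam whose coefficients
    span F_d / F_{d+1}, as the binomials C(d, s) are invertible in K.  At a
    generic parameter its first h_d derivatives are linearly independent, by
    a Vandermonde determinant that is nonzero in characteristic 0 or > d
    ([osculating_free]).  For c <= i the c-th derivative is a multiple of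
    b^c l^(d-c), which lies in l^k F_i ([osculating_mono]).  The same estimate
    gives min (h_{i+k}, i+1) <= h_i, which is what makes the superlevel sets
    intervals.  The argument only involves a filtration and a map shifting it,
    hence applies to L and to the associated graded algebra
    ([jordan_type_filtered]).

    Majorization.  The space K^n is in general not a cyclic L-module, so the
    ranks of B^k on K^n and on L have to be compared.  Number the parts of P
    from 0 and let q = p_i; then B^q K^n is generated over K[B] by i elements,
    coming from the first i Jordan strings, as the others are killed by B^q.
    Cayley-Hamilton for A over K[B] gives a relation expressing A^i B^q by the
    A^t B^q K[B] with t < i ([power_reduction]).  Hence L / b^k L is spanned
    by the a^i b^e with e < min (p_i, k) ([dim_pow_coker_le]).  As dim L = n,
    the rank of b^k on L is at least [excess k P], while the upper bound,
    applied to c = b, says that it is at most [excess k P(H)]. *)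

Set Implicit Arguments.
Unset Strict Implicit.
Unset Printing Implicit Defensive.

Import GRing.Theory.

(** * Partitions, conjugates and superlevel sets *)

(** The rank of the [k]-th power of a nilpotent endomorphism with Jordan
    block sizes [P]. *)
Definition excess (k : nat) (P : seq nat) : nat := \sum_(p <- P) (p - k).

Lemma dual_partition_sort (s : seq nat) :
  dual_partition (sort geq s) = dual_partition s.
Proof.
rewrite /dual_partition; have pe : perm_eq (sort geq s) s by rewrite perm_sort.
rewrite (perm_big _ pe) /=; apply: eq_map => i.
exact: (seq.permP pe).
Qed.

Lemma sorted_dual_partition (s : seq nat) : sorted geq (dual_partition s).
Proof.
rewrite /dual_partition sorted_map.
apply: (@sub_sorted _ ltn); last exact: iota_ltn_sorted.
move=> x y /= xy; apply: sub_count => z /= yz; exact: ltn_trans yz.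
Qed.

Lemma dual_partition_gt0 (s : seq nat) : 0 \notin dual_partition s.
Proof.
apply/mapP => -[i]; rewrite mem_iota add0n => /= /[swap] c0.
have /hasPn nh : ~~ has (fun x => i < x) s by rewrite has_count -c0.
apply/negP; rewrite -leqNgt; apply/bigmax_leqP_seq => x xs _.
by rewrite leqNgt nh.
Qed.

Section HilbertCounts.
Variables (h : nat -> nat) (j : nat).
Let s := mkseq h j.+1.
Let nu := \max_(x <- s) x.

Let h_le_nu d : d < j.+1 -> h d <= nu.
Proof.
move=> dj; apply: (@leq_bigmax_seq _ s xpredT id) => //.
by apply/mapP; exists d; rewrite // mem_iota.
Qed.

(** Layer-cake formula, used to exchange sums of values of [h] with
    cardinals of superlevel sets. *)
Lemma sum_superlevel (x N : nat) : x <= N -> \sum_(t < N) (t < x) = x.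
Proof.
suff -> : \sum_(t < N) (t < x) = minn x N by move/minn_idPl.
by elim: N => [|N IH]; rewrite ?big_ord0 ?minn0 // big_ord_recr /= IH; lia.
Qed.

Lemma excess_dual_partition k :
  excess k (dual_partition s) =
    \sum_(t < nu) (\sum_(d < j.+1) (t < h d) - k).
Proof.
rewrite /excess /dual_partition -/nu big_map -(big_mkord xpredT (fun t => \sum_(d < j.+1) (t < h d) - k)).
rewrite /index_iota subn0.
apply: eq_bigr => t _; congr (_ - _).
rewrite /s /mkseq count_map -sum1_count /= big_mkcond /=.
rewrite -(big_mkord xpredT (fun d => (t < h d) : nat)).
by rewrite /index_iota subn0; apply: eq_bigr => d _; case: ifP.
Qed.

Hypothesis h_le : forall d, h d <= d.+1.

(** A part of the dual partition is the cardinal of a superlevel set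
    [{d | t < h d}], which lies in [[t, oo)] as [h d <= d.+1].  Discarding its
    elements below [t + k] removes at most [k] of them, and a remaining [d]
    is counted in [minn (h d) (d - k).+1]. *)
Lemma excess_dual_le k :
  excess k (dual_partition s) <= \sum_(k <= d < j.+1) minn (h d) (d - k).+1.
Proof.
have -> : \sum_(k <= d < j.+1) minn (h d) (d - k).+1 =
    \sum_(t < nu) \sum_(k <= d < j.+1) ((t < h d) && (t <= d - k)).
  rewrite exchange_big /= big_nat_cond [RHS]big_nat_cond; apply: eq_bigr => d.
  case/andP=> /andP[kd dj] _; rewrite -[LHS](@sum_superlevel _ nu) //.
    by apply: eq_bigr => t _; rewrite leq_min ltnS.
  by rewrite geq_min h_le_nu.
rewrite excess_dual_partition; apply: leq_sum => t _.
have -> : \sum_(d < j.+1) (t < h d) = \sum_(t <= d < j.+1) (t < h d).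
  rewrite -(big_mkord xpredT (fun d => (t < h d) : nat)).
  have [tj|tj] := leqP t j.+1.
    rewrite (@big_cat_nat _ _ _ t) //= [X in X + _]big_nat_cond big1 // => d.
    case/andP=> /andP[_ dt] _; apply/eqP; rewrite eqb0 -leqNgt.
    exact: leq_trans (h_le d) _.
  rewrite [RHS]big_geq; last exact: ltnW.
  rewrite big_nat_cond big1 // => d /andP[/andP[_ dj] _].
  apply/eqP; rewrite eqb0 -leqNgt; apply: leq_trans (h_le d) _; lia.
have [tkj|jtk] := leqP (t + k) j.+1; last first.
  apply: (@leq_trans 0) => //; rewrite leqn0 subn_eq0.
  apply: (@leq_trans (\sum_(t <= d < j.+1) 1)); first by apply: leq_sum => d _; case: (_ < _).
  by rewrite sum_nat_const_nat; lia.
rewrite (@big_cat_nat _ _ _ (t + k) t) //=; last by rewrite leq_addr.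
rewrite [X in _ <= X](@big_cat_nat _ _ _ (t + k) k) //=; last by rewrite leq_addl.
have le1 : \sum_(t <= d < t + k) (t < h d) <= k.
  apply: (@leq_trans (\sum_(t <= d < t + k) 1)); first by apply: leq_sum => d _; case: (_ < _).
  by rewrite sum_nat_const_nat; lia.
rewrite leq_subLR; apply: leq_add => //; apply: leq_trans (leq_addl _ _).
rewrite big_nat_cond [X in _ <= X]big_nat_cond; apply: leq_sum => d /andP[/andP[td _] _].
by rewrite (_ : t <= d - k = true) ?andbT //; lia.
Qed.

Hypothesis h0 : forall d, j < d -> h d = 0.
(** This condition of Macaulay type makes every nonempty superlevel
    set [{d | t < h d}] an interval starting at [t]. *)
Hypothesis h_min : forall i k, minn (h (i + k)) i.+1 <= h i.

(** Take for [i] the least index with [h (i + k) <= i].  The window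
    [[i, i + k)] then contains the superlevel sets of all [t >= i] and is
    contained in those of all [t < i], so removing it shortens each part by
    exactly [k], or to zero. *)
Lemma excess_dual_ge k : exists i,
  \sum_(d < j.+1 | (d < i) || (i + k <= d)) h d <= excess k (dual_partition s).
Proof.
have ex : exists i, h (i + k) <= i.
  by exists j.+1; rewrite h0 //; lia.
pose i := ex_minn ex; exists i.
have [hi imin] : h (i + k) <= i /\ forall i', i' < i -> i' < h (i' + k).
  rewrite /i; case: ex_minnP => {}i hi imin; split=> // i' i'i.
  by rewrite ltnNge; apply/negP => /imin; lia.
have mono t d d' : t < h d -> t <= d' -> d' <= d -> t < h d'.
  move=> th td' d'd; have := h_min d' (d - d').
  by rewrite subnKC // geq_min; lia.
have -> : \sum_(d < j.+1 | (d < i) || (i + k <= d)) h d =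
    \sum_(t < nu) \sum_(d < j.+1 | (d < i) || (i + k <= d)) (t < h d).
  by rewrite exchange_big; apply: eq_bigr => d _; rewrite sum_superlevel ?h_le_nu.
rewrite excess_dual_partition; apply: leq_sum => t _.
have [ti|it] := ltnP t i; last first.
  rewrite big1 // => d dP; apply/eqP; rewrite eqb0 -leqNgt.
  case/orP: dP => [di|ikd]; first by have := h_le d; lia.
  rewrite leqNgt; apply/negP => td.
  have : i < h (i + k) by apply: (mono _ d) => //; lia.
  lia.
have i1 : i.-1 < h (i.-1 + k) by apply: imin; lia.
have win d : t <= d < t + (i + k - t) -> t < h d.
  by move=> dP; apply: (mono _ (i.-1 + k)); lia.
rewrite [X in _ <= X - _](bigID (fun d : 'I__ => (d < i) || (i + k <= d))) /=.
suff -> : \sum_(d < j.+1 | ~~ ((d < i) || (i + k <= d))) (t < h d) = k by rewrite addnK.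
rewrite (eq_bigr (fun=> 1)) => [|d dP]; last by rewrite (win d) //; lia.
have ikj : i + k <= j.+1.
  rewrite leqNgt; apply/negP => ikj.
  by move: i1; rewrite h0 //; lia.
rewrite big_mkcond (eq_bigr (fun d : 'I__ => (i <= d < i + k) : nat)) => [|d _].
  suff count_window N : \sum_(d < N) (i <= d < i + k) = minn (i + k) N - minn i N.
    by rewrite count_window; lia.
  by elim: N => [|N IH]; rewrite ?big_ord0 ?minn0 // big_ord_recr /= IH; lia.
by rewrite negb_or -leqNgt -ltnNge; case: (_ && _).
Qed.

End HilbertCounts.

(** To compare the sums of the first [i] parts, use the excesses at level
    [k = nth 0 Q i]: for [Q] the sum is exactly [excess k Q + i * k], while for
    any partition it is at most the corresponding quantity. *)
Lemma majorizes_excess (P Q : seq nat) :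
  sorted geq Q -> (forall k, excess k P <= excess k Q) -> majorizes Q P.
Proof.
move=> sQ le_ex i; set k := nth 0 Q i.
have cutP : sumn (take i P) <= excess k P + size (take i P) * k.
  rewrite -{2}(cat_take_drop i P) /excess big_cat /= sumnE.
  apply: (@leq_trans (\sum_(p <- take i P) ((p - k) + k))).
    by apply: leq_sum => p _; lia.
  by rewrite big_split /= big_const_seq count_predT iter_addn_0 mulnC; lia.
have geqtr : transitive geq by move=> x y z /= xy yz; apply: leq_trans yz xy.
have [iQ|Qi] := ltnP i (size Q); last first.
  have k0 : k = 0 by rewrite /k nth_default.
  have := le_ex 0; rewrite k0 in cutP.
  have ex0 R : excess 0 R = sumn R.
    by rewrite sumnE; apply: eq_bigr => p _; rewrite subn0.
  by rewrite (take_oversize Qi) -(ex0 Q); lia.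
have cutQ : sumn (take i Q) = excess k Q + i * k.
  rewrite -{2}(cat_take_drop i Q) /excess big_cat /= sumnE.
  rewrite [X in _ + X + _](@big1_seq) ?addn0 => [|p]; last first.
    case/andP=> _ /(nthP 0)[l]; rewrite size_drop nth_drop => ls <-.
    apply/eqP; rewrite subn_eq0; move: ls; rewrite ltn_subRL => il.
    exact: (sorted_leq_nth geqtr leqnn 0 sQ i (i + l) iQ il (leq_addr l i)).
  have -> : i * k = \sum_(p <- take i Q) k.
    by rewrite big_const_seq count_predT iter_addn_0 size_takel ?(ltnW iQ) // mulnC.
  rewrite -big_split /=.
  apply: eq_big_seq => p /(nthP 0)[l]; rewrite size_takel ?(ltnW iQ) // => li <-.
  rewrite nth_take // subnK //.
  exact: (sorted_leq_nth geqtr leqnn 0 sQ l i (ltn_trans li iQ) iQ (ltnW li)).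
have := le_ex k; have : size (take i P) * k <= i * k by rewrite leq_mul2r size_take_min geq_minl orbT.
by rewrite cutQ; lia.
Qed.

(** Block multiplicities are second differences of the ranks. *)
Lemma excess_count (P : seq nat) q :
  excess q P + excess q.+2 P = 2 * excess q.+1 P + count_mem q.+1 P.
Proof.
elim: P => [|p P IH]; first by rewrite /excess !big_nil.
move: IH; rewrite /excess !big_cons /=; case: eqVneq => [->|]; lia.
Qed.

(** * Jordan type of a nilpotent endomorphism from the ranks of its powers *)

Local Open Scope ring_scope.

Lemma jordan_mxE (K : fieldType) (P : seq nat) (i k : 'I_(size P))
    (a : 'I_(nth 0%N P i)) (b : 'I_(nth 0%N P k)) :
  jordan_mx K P (tagnat.Rank i a) (tagnat.Rank k b) =
    ((i == k) && (a.+1 == b :> nat))%:R.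
Proof.
have -> : jordan_mx K P (tagnat.Rank i a) (tagnat.Rank k b) =
    submxblock (jordan_mx K P) i k a b by rewrite [RHS]mxE.
rewrite /jordan_mx /mxdiag mxblockK; case: eqVneq => [ik|_]; last by rewrite mxE.
by case: _ / ik in b *; rewrite conform_mx_id mxE.
Qed.

Section NilpotentStrings.
Variables (K : fieldType) (V : vectType K) (f : 'End(V)).

Definition lfun_pow (k : nat) : 'End(V) := iter k (comp_lfun f) \1%VF.

Lemma lfun_powE k x : lfun_pow k x = iter k f x.
Proof. by elim: k => [|k IH]; rewrite /= ?id_lfunE // comp_lfunE IH. Qed.

(** Strings of the prescribed lengths that generate [V] have [dim V] vectors
    in total, hence form a basis.  Generation is expressed through stable
    subspaces, which avoids handling the strings outside of this proof. *)
Lemma has_jordan_type_of_strings (P : seq nat) (g : nat -> V) :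
    \dim {:V} = sumn P ->
    (forall a, (a < size P)%N -> iter (nth 0%N P a) f (g a) = 0) ->
    (forall U : {vspace V}, (f @: U <= U)%VS ->
       (forall a, (a < size P)%N -> g a \in U) -> U = fullv) ->
  has_jordan_type f P.
Proof.
move=> dimV g0 gspan.
have sumP : (\sum_(i < size P) nth 0 P i = sumn P)%N.
  by rewrite sumnE (big_nth 0%N) big_mkord.
pose N := (\sum_(i < size P) nth 0 P i)%N.
pose str (s : 'I_N) := iter (nth 0%N P (tagnat.sig1 s) - (tagnat.sig2 s).+1) f (g (tagnat.sig1 s)).
pose X : N.-tuple V := [tuple str s | s < N].
pose R := @tagnat.Rank _ (fun i : 'I_(size P) => nth 0%N P i).
have strR (i : 'I_(size P)) (a : 'I_(nth 0%N P i)) :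
    str (tagnat.Rank i a) = iter (nth 0%N P i - a.+1) f (g i).
  have e2 : nat_of_ord (tagnat.sig2 (R i a)) = a by rewrite tagnat.Rank2K.
  by rewrite /str [tagnat.Rank i a]/(R i a) e2 tagnat.Rank1K.
have fstr (i : 'I_(size P)) (a : 'I_(nth 0%N P i)) :
    f (str (tagnat.Rank i a)) = iter (nth 0%N P i - a) f (g i).
  by rewrite strR -iterS subnSK.
have memX s : str s \in <<X>>%VS by rewrite -(tnth_mktuple str s) memv_span ?mem_tnth.
have Xfull : <<X>>%VS = fullv.
  apply: gspan => [|a aP].
    rewrite limg_span; apply/span_subvP => _ /mapP[_ /tnthP[s ->] ->]; rewrite tnth_mktuple.
    rewrite -(tagnat.sig2K s); move: (tagnat.sig1 s) (tagnat.sig2 s) => i a.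
    rewrite fstr; case: (posnP a) => [a0|a0].
      by rewrite a0 subn0 g0 ?mem0v.
    have a1 : (a.-1 < nth 0 P i)%N by have := ltn_ord a; lia.
    have := memX (tagnat.Rank i (Ordinal a1)); rewrite strR /=.
    by rewrite prednK.
  have [p0|p_gt0] := posnP (nth 0%N P a).
    by have := g0 a aP; rewrite p0 /= => ->; rewrite mem0v.
  have p1 : ((nth 0 P (Ordinal aP)).-1 < nth 0 P (Ordinal aP))%N by rewrite prednK.
  have := memX (tagnat.Rank (Ordinal aP) (Ordinal p1)); rewrite strR /=.
  by rewrite prednK // subnn.
exists X.
  by rewrite basisEdim Xfull subvv dimV size_tuple /N sumP leqnn.
move=> s; rewrite tnth_mktuple -(tagnat.sig2K s).
move: (tagnat.sig1 s) (tagnat.sig2 s) => k b; rewrite fstr.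
have coef (t : 'I_N) : jordan_mx K P t (tagnat.Rank k b) != 0 ->
    (tagnat.sig1 t == k) && ((tagnat.sig2 t).+1 == b :> nat).
  rewrite -{1}(tagnat.sig2K t) jordan_mxE.
  by case: (_ && _); rewrite ?eqxx.
have [b0|b_gt0] := posnP b.
  rewrite b0 subn0 g0 // big1 // => t _.
  have [->|/coef] := eqVneq (jordan_mx K P t (tagnat.Rank k b)) 0; first by rewrite scale0r.
  by rewrite b0 andbF.
have b1 : (b.-1 < nth 0 P k)%N by have := ltn_ord b; lia.
rewrite (bigD1 (tagnat.Rank k (Ordinal b1))) //= [X in _ + X]big1 => [|t tn].
  rewrite jordan_mxE eqxx /= prednK // eqxx scale1r addr0 tnth_mktuple strR /=.
  by rewrite prednK.
have [->|/coef/andP[/eqP e1 /eqP e2]] := eqVneq (jordan_mx K P t (tagnat.Rank k b)) 0.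
  by rewrite scale0r.
case/eqP: tn; apply/eqP; rewrite -val_eqE -(tagnat.sig2K t) tagnat.eq_Rank.
by apply/andP; split; [exact/eqP | rewrite /= -e2].
Qed.

Lemma count_mem_take_nth (P : seq nat) (q t : nat) : (t < count_mem q P)%N ->
  exists2 a, (a < size P)%N & nth 0%N P a = q /\ count_mem q (take a P) = t.
Proof.
elim: P t => [|p P IH] t //=.
have [->|pq] := eqVneq p q; last first.
  rewrite add0n => /IH[a aP [nq ct]]; exists a.+1 => //=.
  by rewrite (negbTE pq) add0n.
case: t => [_|t]; first by exists 0%N.
rewrite add1n ltnS => /IH[a aP [nq ct]]; exists a.+1 => //=.
by rewrite eqxx ct.
Qed.

(** Let [ker q] be the kernel of [f ^ q].  The generators of the strings of
    length [q.+1] are chosen as a basis of a complement [C q] of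
    [ker q + f (ker q.+2)] in [ker q.+1].  The dimension of [C q] is the
    second difference of the ranks, that is the multiplicity of [q.+1] in [P].
    Descending induction on [q] shows that the strings generate
    [ker q.+1] modulo [ker q]. *)
Lemma has_jordan_type_of_ranks (P : seq nat) : 0%N \notin P ->
  (forall k, \dim (limg (lfun_pow k)) = excess k P) -> has_jordan_type f P.
Proof.
move=> P0 rk.
pose ker q := lker (lfun_pow q).
have mem_ker q x : (x \in ker q) = (iter q f x == 0).
  by rewrite memv_ker lfun_powE.
have excess0 : excess 0 P = sumn P.
  by rewrite sumnE; apply: eq_bigr => p _; rewrite subn0.
have dimV : \dim {:V} = sumn P.
  rewrite -excess0 -rk; congr (\dim _); apply/esym.
  by apply/vspaceP => x; rewrite memvf -[x]/(iter 0 f x) -lfun_powE memv_img ?memvf.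
have dim_ker q : (\dim (ker q) + excess q P = sumn P)%N.
  by rewrite -rk -dimV -(limg_ker_dim (lfun_pow q) fullv) capfv.
have dim_fker q : (\dim (f @: ker q.+1) + \dim (ker 1) = \dim (ker q.+1))%N.
  rewrite -(limg_ker_dim f (ker q.+1)) addnC; congr (\dim _ + _)%N.
  apply/vspaceP => x; rewrite memv_cap memv_ker !mem_ker /= -iterS iterSr.
  by apply/idP/andP => [/eqP->|[_ ->]] //; split=> //; elim: q => [|q IH]; rewrite ?linear0 // iterS (eqP IH) linear0.
pose L q := (ker q + f @: ker q.+2)%VS.
have L_ker q : (L q <= ker q.+1)%VS.
  rewrite subv_add; apply/andP; split; apply/subvP => x.
    by rewrite !mem_ker /= => /eqP->; rewrite linear0.
  by case/memv_imgP => y; rewrite !mem_ker => /eqP yk ->; rewrite -iterSr yk.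
have dim_L q : (\dim (L q) + \dim (ker q.+1) = \dim (ker q) + \dim (ker q.+2))%N.
  have := dimv_sum_cap (ker q) (f @: ker q.+2)%VS.
  have -> : (ker q :&: f @: ker q.+2 = f @: ker q.+1)%VS.
    apply/vspaceP => x; rewrite memv_cap mem_ker; apply/andP/idP.
      case=> xq /memv_imgP[y _ xy]; rewrite xy memv_img // mem_ker.
      by rewrite iterSr -xy.
    case/memv_imgP => y; rewrite mem_ker => /eqP yk ->; rewrite -iterSr yk.
    by split=> //; rewrite memv_img // mem_ker iterS yk linear0.
  by have := dim_fker q; have := dim_fker q.+1; rewrite -/(L q); lia.
pose C q := (ker q.+1 :\: L q)%VS.
have dim_C q : \dim (C q) = count_mem q.+1 P.
  have := dimv_cap_compl (ker q.+1) (L q); rewrite (capv_idPr (L_ker q)) -/(C q).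
  have := excess_count P q.
  have := dim_L q; have := dim_ker q; have := dim_ker q.+1; have := dim_ker q.+2.
  lia.
(* The equal parts of [P] are matched with the vectors of one basis: the
   index of a part among its copies is its number of earlier copies. *)
pose g a := let q := (nth 0 P a).-1 in nth 0 (vbasis (C q)) (count_mem q.+1 (take a P)).
have memg a : (a < size P)%N -> g a \in ker (nth 0%N P a).
  move=> aP; have pa : (0 < nth 0 P a)%N.
    by rewrite lt0n; apply: contraNneq P0 => <-; rewrite mem_nth.
  pose q := (nth 0 P a).-1; have pq : nth 0%N P a = q.+1 by rewrite prednK.
  rewrite pq; apply: (subvP (diffvSl _ (L q))); rewrite /g -/q.
  apply: vbasis_mem; apply: mem_nth.
  rewrite size_tuple dim_C -{2}(cat_take_drop a P) count_cat (drop_nth 0%N aP) /=.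
  by rewrite pq eqxx; lia.
apply: (@has_jordan_type_of_strings P g) => // [a aP|U fU gU].
  by apply/eqP; rewrite -mem_ker memg.
have CU q : (C q <= U)%VS.
  rewrite -(span_basis (vbasisP (C q))); apply/span_subvP => x xC.
  have [a aP [nq ct]] : exists2 a, (a < size P)%N & nth 0%N P a = q.+1 /\
      count_mem q.+1 (take a P) = index x (vbasis (C q)).
    by apply: count_mem_take_nth; rewrite -dim_C -[X in (_ < X)%N](size_tuple (vbasis (C q))) index_mem.
  by have := gU a aP; rewrite /g nq /= ct nth_index.
pose M := sumn P.
have ker_full q : (M <= q)%N -> ker q = fullv.
  move=> Mq; apply/eqP; rewrite eqEdim subvf /= dimV -(dim_ker q) -[leqRHS]addn0.
  rewrite leq_add2l leqn0; apply/eqP; rewrite /excess big1_seq // => p /= pP.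
  apply/eqP; rewrite subn_eq0; apply: leq_trans Mq.
  by rewrite /M sumnE (big_rem p) //= leq_addr.
(* Descending induction on [q], starting at [M] where the kernels have
   become stationary. *)
have step t q : (q + t = M)%N -> (ker q.+1 <= U + ker q)%VS.
  elim: t q => [|t IH] q qM.
    rewrite (_ : ker q = fullv) ?addvf ?subvf //; apply: ker_full; lia.
  have -> : ker q.+1 = (C q + L q)%VS.
    by rewrite addv_diff (addv_idPl (L_ker q)).
  rewrite subv_add (subv_trans (CU q)) ?addvSl //= subv_add addvSr /=.
  apply: subv_trans (limgS f (IH q.+1 _)) _; first by lia.
  rewrite limgD addvS //; apply/subvP => _ /memv_imgP[y yk ->].
  by move: yk; rewrite !mem_ker -iterSr.
have kerU q : (q <= M)%N -> (ker q <= U)%VS.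
  elim: q => [|q IH] qM.
    by apply/subvP => x; rewrite mem_ker /= => /eqP->; rewrite mem0v.
  apply: subv_trans (step (M - q)%N q _) _; first by lia.
  by rewrite subv_add subvv IH //; lia.
by apply/eqP; rewrite eqEsubv subvf -(ker_full M) ?kerU.
Qed.

End NilpotentStrings.

(** * Endomorphisms that shift a filtration *)

(** The kernel of [f] on [U2] is contained in its kernel on [U1]. *)
Lemma dim_limg_le (K : fieldType) (V W : vectType K) (f : 'Hom(V, W))
    (U1 U2 : {vspace V}) : (U2 <= U1)%VS ->
  (\dim (f @: U1) + \dim U2 <= \dim U1 + \dim (f @: U2))%N.
Proof.
move=> U21; rewrite -(limg_ker_dim f U1) -(limg_ker_dim f U2).
have : (\dim (U2 :&: lker f) <= \dim (U1 :&: lker f))%N by rewrite dimvS ?capvS.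
lia.
Qed.

Section FilteredEndomorphism.
Variables (K : fieldType) (V : vectType K) (f : 'End(V)).
Variables (F : nat -> {vspace V}) (h : nat -> nat) (j : nat).
Hypotheses (F0 : F 0 = fullv) (Fj : F j.+1 = 0%VS).
Hypotheses (F_dec : forall i, (F i.+1 <= F i)%VS).
Hypothesis f_shift : forall i, (f @: F i <= F i.+1)%VS.
Hypothesis dim_F : forall i, \dim (F i) = (h i + \dim (F i.+1))%N.
Hypothesis h_le : forall i, (h i <= i.+1)%N.

Let F_le i i' : (i <= i')%N -> (F i' <= F i)%VS.
Proof.
move=> ii'; rewrite -(subnKC ii'); elim: (i' - i)%N => [|t IH]; first by rewrite addn0.
by rewrite addnS (subv_trans (F_dec _)).
Qed.

Let F_eq0 i : (j < i)%N -> F i = 0%VS.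
Proof. by move=> ji; apply/eqP; rewrite -subv0 -Fj F_le. Qed.

Let h_eq0 i : (j < i)%N -> h i = 0%N.
Proof. by move=> ji; have := dim_F i; rewrite !F_eq0 ?dimv0 //; lia. Qed.

Let pow_shift k i : (lfun_pow f k @: F i <= F (i + k))%VS.
Proof.
elim: k => [|k IH]; first by rewrite addn0 /= lim1g.
by rewrite addnS /= limg_comp (subv_trans (limgS f IH)).
Qed.

Let dim_F_sum i : \dim (F i) = (\sum_(d < j.+1 | i <= d) h d)%N.
Proof.
have [ij|ji] := leqP i j.+1; last first.
  by rewrite F_eq0 ?dimv0 ?big_pred0 // => [d|]; [have := ltn_ord d|]; lia.
rewrite -(subKn ij); elim: (j.+1 - i)%N (leq_subr i j.+1) => [|t IH] tj.
  rewrite subn0 Fj dimv0 big_pred0 // => d; have := ltn_ord d; lia.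
have tj' : (j.+1 - t.+1 < j.+1)%N by lia.
rewrite dim_F (_ : (j.+1 - t.+1).+1 = j.+1 - t)%N; last lia.
rewrite IH ?(ltnW tj) // [RHS](bigD1 (Ordinal tj')) //=; congr addn.
by apply: eq_bigl => d; rewrite -val_eqE /=; lia.
Qed.

Let Q := dual_partition (mkseq h j.+1).

(** As [f ^ k] maps [F i] into [F (i + k)], its rank is at most
    [dim (V / F i) + dim (F (i + k))] for every [i]. *)
Lemma rank_pow_le k : (forall i l, minn (h (i + l)) i.+1 <= h i)%N ->
  (\dim (limg (lfun_pow f k)) <= excess k Q)%N.
Proof.
move=> h_min; have [i] := excess_dual_ge h_le h_eq0 h_min k; apply: leq_trans.
have := dim_limg_le (lfun_pow f k) (subvf (F i)).
have := dimvS (pow_shift k i); rewrite -F0 !dim_F_sum.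
have -> : (\sum_(d < j.+1 | (d < i) || (i + k <= d)) h d =
    \sum_(d < j.+1 | d < i) h d + \sum_(d < j.+1 | i + k <= d) h d)%N.
  rewrite (bigID (fun d : 'I__ => d < i)%N) /=.
  by congr addn; apply: eq_bigl => d; lia.
have -> : (\sum_(d < j.+1 | 0 <= d) h d =
    \sum_(d < j.+1 | d < i) h d + \sum_(d < j.+1 | i <= d) h d)%N.
  rewrite (bigID (fun d : 'I__ => d < i)%N) /=.
  by congr addn; apply: eq_bigl => d; lia.
lia.
Qed.

(** The map [F i -> F (i + k) / F (i + k).+1] induced by [f ^ k] has rank at
    least [minn (h (i + k)) i.+1]. *)
Hypothesis lefschetz : forall i k, (i + k <= j)%N ->
  (minn (h (i + k)) i.+1 + \dim (F (i + k).+1) <=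
   \dim (lfun_pow f k @: F i + F (i + k).+1))%N.

(** The map induced by [f ^ k] on [F i] factors through [F i / F i.+1]. *)
Lemma lefschetz_growth i k : (minn (h (i + k)) i.+1 <= h i)%N.
Proof.
have [ikj|jik] := leqP (i + k) j; last by rewrite h_eq0 ?min0n.
have := lefschetz ikj; have := dim_limg_le (lfun_pow f k) (F_dec i).
have := dim_F i; have := dimv_sum_cap (lfun_pow f k @: F i)%VS (F (i + k).+1).
have /dimvS : (lfun_pow f k @: F i.+1 <= lfun_pow f k @: F i :&: F (i + k).+1)%VS.
  by rewrite subv_cap limgS //= -addSn pow_shift.
lia.
Qed.

(** The images of the induced maps lie in the successive quotients of the
    filtration that [F] cuts out on the image of [f ^ k]; their dimensions
    add up. *)
Lemma rank_pow_ge k : (excess k Q <= \dim (limg (lfun_pow f k)))%N.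
Proof.
apply: leq_trans (@excess_dual_le h j h_le k) _.
set W := limg _.
have [kj|jk] := leqP k j.+1; last by rewrite big_geq //; lia.
suff Wd d : (k <= d <= j.+1)%N ->
    (\sum_(d <= e < j.+1) minn (h e) (e - k).+1 <= \dim (W :&: F d))%N.
  by apply: leq_trans (Wd k _) _; rewrite ?leqnn // dimvS ?capvSl.
case/andP=> kd dj; move: kd; rewrite -(subKn dj).
elim: (j.+1 - d)%N (leq_subr d j.+1) => [|t IH] tj kd.
  by rewrite big_geq //; lia.
set d' := (j.+1 - t.+1)%N in kd *.
have d'S : (j.+1 - t = d'.+1)%N by rewrite /d'; lia.
rewrite big_ltn; last by rewrite /d'; lia.
have := IH (ltnW tj); rewrite d'S => /(_ (leqW kd)) IH'.
have := dimv_sum_cap (W :&: F d')%VS (F d'.+1).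
rewrite -capvA (capv_idPr (F_dec d')).
have lef := @lefschetz (d' - k) k; rewrite subnK // in lef.
have /dimvS : (lfun_pow f k @: F (d' - k) + F d'.+1 <= (W :&: F d') + F d'.+1)%VS.
  rewrite addvS // subv_cap limgS ?subvf //=.
  by have := pow_shift k (d' - k); rewrite subnK.
have := lef _; rewrite {1}/d' => /(_ ltac:(lia)); lia.
Qed.

Theorem jordan_type_filtered : has_jordan_type f Q.
Proof.
apply: has_jordan_type_of_ranks (dual_partition_gt0 _) _ => k.
by apply/eqP; rewrite eqn_leq rank_pow_ge rank_pow_le //; apply: lefschetz_growth.
Qed.

End FilteredEndomorphism.

(** * Derivatives of a spanning polynomial curve at a generic parameter *)

Section FallingFactorial.
Variable R : idomainType.

Definition ffact_poly (b : nat) : {poly R} := \prod_(t < b) ('X - t%:R%:P).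

Lemma horner_ffact_poly b s : (ffact_poly b).[s%:R] = (s ^_ b)%:R.
Proof.
rewrite /ffact_poly; elim: b => [|b IH]; first by rewrite big_ord0 hornerE.
rewrite big_ord_recr /= hornerM IH !hornerE ffactnSr natrM.
by have [bs|sb] := leqP b s; [rewrite natrB | rewrite ffact_small // !mul0r].
Qed.

(** The falling factorials [ffact_poly b] are monic of degree [b], so this
    matrix is a unitriangular matrix times a Vandermonde matrix. *)
Lemma det_ffact (h : nat) (s : 'I_h -> nat) :
    (forall a a' : 'I_h, (a < a')%N -> (s a')%:R - (s a)%:R != 0 :> R) ->
  \det (\matrix_(b < h, a < h) (s a ^_ b)%:R) != 0 :> R.
Proof.
move=> inj_s.
pose T : 'M[R]_h := \matrix_(b, e) (ffact_poly b)`_e.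
have sz b : size (ffact_poly b) = b.+1.
  by rewrite size_prod_XsubC /index_enum -enumT size_enum_ord.
have lc b : (ffact_poly b)`_b = 1.
  have := monicP (monic_prod_XsubC (index_enum 'I_b) xpredT (fun t => t%:R : R)).
  by rewrite lead_coefE -/(ffact_poly b) sz.
have -> : \matrix_(b < h, a < h) (s a ^_ b)%:R =
    T *m Vandermonde h (\row_a (s a)%:R).
  apply/matrixP => b a; rewrite !mxE -horner_ffact_poly.
  rewrite (@horner_coef_wide _ h) ?sz //.
  by apply: eq_bigr => e _; rewrite !mxE.
rewrite det_mulmx det_trig; last first.
  by apply/is_trig_mxP => b e be; rewrite mxE nth_default // sz.
rewrite (eq_bigr (fun=> 1)) => [|b _]; last by rewrite mxE lc.
rewrite big1 // mul1r det_Vandermonde.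
apply/prodf_neq0 => a _; apply/prodf_neq0 => a' aa'.
by rewrite !mxE inj_s.
Qed.

End FallingFactorial.

Lemma separating_functional (K : fieldType) (U : vectType K)
    (E : {vspace U}) (x : U) : x \notin E ->
  exists2 phi : 'Hom(U, K^o), {in E, forall y, phi y = 0} & phi x = 1.
Proof.
move=> xE; pose pi := daddv_pi (E^C) E.
have capE : (E^C :&: E = 0)%VS by rewrite capvC capv_compl.
have piE y : pi y + daddv_pi E (E^C) y = y.
  by rewrite daddv_pi_add // addvC addv_complf memvf.
have px : pi x != 0.
  by apply: contraNneq xE => p0; rewrite -(piE x) p0 add0r memv_pi.
pose X := vbasis (fullv : {vspace U}).
have /existsP[i ci] : [exists i, coord X i (pi x) != 0].
  apply: contraNT px => /existsPn c0; rewrite (coord_vbasis (memvf (pi x))).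
  by rewrite big1 // => i _; have := c0 i; rewrite negbK => /eqP->; rewrite scale0r.
pose c : 'Hom(U, K^o) := linfun (coord X i : U -> K^o).
exists ((coord X i (pi x))^-1 *: (c \o pi)%VF) => [y yE|].
  rewrite scale_lfunE comp_lfunE; have -> : pi y = 0.
    apply: (addIr (daddv_pi E (E^C) y)); rewrite piE add0r daddv_pi_id //.
    exact: capv_compl.
  by rewrite linear0 scaler0.
by rewrite scale_lfunE comp_lfunE lfunE; apply: mulVf.
Qed.


Section GenericIndependence.
Variables (K : closedFieldType) (U : vectType K) (u : nat -> U) (d : nat).
Hypothesis char_gt : forall t, (0 < t <= d)%N -> t%:R != 0 :> K.

Let E (s : nat) : {vspace U} := <<mkseq u s>>%VS.
(** The indices [s] at which the span of [u 0, ..., u s] grows. *)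
Let pivots := [seq s <- iota 0 d.+1 | u s \notin E s].

Let size_pivots : size pivots = \dim (E d.+1).
Proof.
rewrite /pivots /E; elim: d.+1 => [|r IH]; first by rewrite span_nil dimv0.
rewrite -addn1 iotaD filter_cat size_cat IH /mkseq iotaD map_cat span_cat /= add0n.
rewrite span_seq1; have [ur|ur] /= := boolP (u r \in _).
  by rewrite addn0; congr (\dim _); apply/esym/addv_idPl; rewrite -memvE.
rewrite dimv_disjoint_sum; last first.
  apply/eqP; rewrite -subv0; apply/subvP => x /memv_capP[xE /vlineP[c xc]].
  have [c0|c0] := eqVneq c 0; first by rewrite xc c0 scale0r mem0v.
  by case/negP: ur; rewrite -[u r](scalerK c0) -xc memvZ.
rewrite dim_vline; case: eqVneq ur => // -> ; by rewrite mem0v.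
Qed.

(** With [gamma lam = \sum_s 'C(d, s) lam ^+ s *: u s], this is
    [lam ^+ b] times the [b]-th derivative of [gamma] at [lam]. *)
Definition osculating (lam : K) (b : nat) : U :=
  \sum_(s < d.+1) ('C(d, s) * s ^_ b)%:R * lam ^+ s *: u s.

Let natK_inj s s' : (s < s')%N -> (s' <= d)%N -> s'%:R - s%:R != 0 :> K.
Proof. by move=> ss' s'd; rewrite -natrB ?char_gt //; lia. Qed.

Let binK s : (s <= d)%N -> 'C(d, s)%:R != 0 :> K.
Proof.
move=> sd; have fd m : (m <= d)%N -> m`!%:R != 0 :> K.
  elim: m => [|m IH] md; first by rewrite oner_neq0.
  by rewrite factS natrM mulf_neq0 ?(IH (ltnW md)) ?char_gt.
by have := fd d (leqnn d); rewrite -(bin_fact sd) natrM mulf_eq0 negb_or => /andP[].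
Qed.

(** For a pivot [s] choose a functional [phi] that vanishes on the [u t] with
    [t < s] and takes the value 1 at [u s].  Its value on [osculating lam b]
    is [lam ^+ s] times a polynomial in [lam] with constant term
    ['C(d, s) * s ^_ b].  The determinant over all pivots is thus a power of
    [lam] times a polynomial whose value at 0 is, up to invertible binomials,
    the determinant of falling factorials; the latter is nonzero since the
    pivots are distinct integers in [[0, d]].  The excluded parameters are 0
    and the roots of that polynomial. *)
Lemma osculating_free : exists r : seq K, forall lam, lam \notin r ->
  free [seq osculating lam b | b <- iota 0 (\dim <<mkseq u d.+1>>)].
Proof.
rewrite -/(E d.+1) -size_pivots; set h := size pivots.
pose p (a : 'I_h) := nth 0%N pivots a.
have p_in (a : 'I_h) : (p a <= d)%N /\ u (p a) \notin E (p a).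
  by have := mem_nth 0%N (ltn_ord a); rewrite mem_filter mem_iota /= add0n => /andP[].
have p_lt (a a' : 'I_h) : (a < a')%N -> (p a < p a')%N.
  have sorted_p : sorted ltn pivots by apply/sorted_filter/iota_ltn_sorted/ltn_trans.
  exact: (sorted_ltn_nth ltn_trans 0%N sorted_p a a' (ltn_ord a) (ltn_ord a')).
have /fin_all_exists[phi phiP] : forall a : 'I_h, exists psi : 'Hom(U, K^o),
    {in E (p a), forall y, psi y = 0} /\ psi (u (p a)) = 1.
  move=> a; have [_ /separating_functional[psi psi0 psi1]] := p_in a.
  by exists psi.
have phiZ a c y : phi a (c *: y) = c * phi a y by exact: linearZ.
have phi0 a s : (s < p a)%N -> phi a (u s) = 0.
  by move=> sa; apply: (phiP a).1; apply/memv_span/map_f; rewrite mem_iota.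
pose M : 'M[{poly K}]_h := \matrix_(b, a) \sum_(s < d.+1)
  (('C(d, s) * s ^_ b)%:R * phi a (u s) : K) *: 'X^(s - p a).
have M_val lam b a : (M b a).[lam] * lam ^+ p a = phi a (osculating lam b).
  rewrite mxE horner_sum mulr_suml linear_sum /=; apply: eq_bigr => s _.
  rewrite phiZ hornerZ hornerXn.
  have [sa|as_] := ltnP s (p a); first by rewrite phi0 // mulr0 !mul0r mulr0.
  by rewrite -mulrA -exprD subnK // mulrAC.
have M0 : map_mx (horner_eval 0) M = 
    (\matrix_(b, a) (p a ^_ b)%:R) *m diag_mx (\row_a 'C(d, p a)%:R).
  apply/matrixP => b a; rewrite mul_mx_diag !mxE /horner_eval horner_sum.
  have [pd _] := p_in a; rewrite -ltnS in pd.
  rewrite (bigD1 (Ordinal pd)) //= big1 => [|s sn].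
    by rewrite hornerZ hornerXn subnn (phiP a).2 mulr1 expr0 mulr1 addr0 natrM mulrC.
  rewrite hornerZ hornerXn; have [sa|as_] := ltnP s (p a).
    by rewrite phi0 // mulr0 mul0r.
  rewrite expr0n subn_eq0 leqNgt ltn_neqAle as_ andbT eq_sym.
  by rewrite -(inj_eq val_inj) /= in sn; rewrite sn mulr0.
have detM : \det M != 0.
  apply/eqP => det0; have /eqP := det_map_mx (horner_eval 0) M.
  rewrite det0 /= rmorph0 M0 det_mulmx mulf_eq0 (negbTE (det_ffact _)) /=; last first.
    by move=> a a' aa'; rewrite natK_inj ?p_lt //; case: (p_in a').
  rewrite det_diag; apply/negP/prodf_neq0 => a _; rewrite mxE binK //.
  by case: (p_in a).
have [r detr] := closed_field_poly_normal (\det M).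
exists (0 :: r) => lam; rewrite inE negb_or => /andP[lam0 lamr].
pose X := [tuple osculating lam b | b < h].
have -> : [seq osculating lam b | b <- iota 0 h] = X.
  by rewrite /X /= -val_enum_ord -map_comp.
apply/freeP => k k0 i.
have : (\row_b k b) *m map_mx (horner_eval lam) M = 0.
  apply/rowP => a; rewrite !mxE; apply: (mulIf (expf_neq0 (p a) lam0)).
  rewrite mul0r mulr_suml; apply: etrans (etrans (congr1 (phi a) k0) (linear0 _)).
  rewrite linear_sum /=.
  apply: eq_bigr => b _; rewrite !mxE phiZ (nth_map b) ?size_enum_ord //.
  by rewrite nth_ord_enum -mulrA -M_val mxE.
have detl : \det (map_mx (horner_eval lam) M) != 0.
  rewrite det_map_mx; apply: contra lamr => lam_root.
  have : root (\det M) lam by [].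
  by rewrite detr rootZ ?lead_coef_eq0 // root_prod_XsubC.
move=> /(congr1 (mulmx^~ (invmx (map_mx (horner_eval lam) M)))).
rewrite mulmxK ?unitmxE ?unitfE // mul0mx => /rowP/(_ i).
by rewrite !mxE.
Qed.

End GenericIndependence.

(** * Reduction of A^i B^q by Cayley-Hamilton *)

(** Row vectors form a [K[B]]-module under right multiplication, generated
    by the first basis vectors of the blocks.  The generators are indexed by
    all natural numbers, with zero beyond the last block, so that any large
    enough number of them can be used. *)
Lemma jordan_form_generators (K : fieldType) (n : nat) (B : 'M[K]_n.+1)
    (P : seq nat) : is_jordan_form B P ->
  exists v : nat -> 'rV[K]_n.+1,
    (forall a, v a *m B ^+ nth 0%N P a = 0) /\
    (forall x, exists c : nat -> {poly K}, forall m, (size P <= m)%N ->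
       x = \sum_(a < m) v a *m horner_mx B (c a)).
Proof.
case=> e defB.
(* [s1 l] and [s2 l] are the block of the index [l] and its position there;
   [w i a] is the basis vector at position [a] of block [i], or 0 if there
   is no such position. *)
pose s1 (l : 'I_n.+1) : nat := tagnat.sig1 (cast_ord (esym e) l).
pose s2 (l : 'I_n.+1) : nat := tagnat.sig2 (cast_ord (esym e) l).
have s1P l : (s1 l < size P)%N by apply: ltn_ord.
have s2P l : (s2 l < nth 0 P (s1 l))%N by apply: ltn_ord.
have BE k l : B k l = ((s1 k == s1 l) && ((s2 k).+1 == s2 l))%:R.
  rewrite defB castmxE -(tagnat.sig2K (cast_ord (esym e) k)).
  by rewrite -(tagnat.sig2K (cast_ord (esym e) l)) jordan_mxE.
have s12_inj l l' : s1 l = s1 l' -> s2 l = s2 l' -> l = l'.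
  move=> e1 e2; apply: (@cast_ord_inj _ _ (esym e)).
  rewrite -[LHS]tagnat.sig2K -[RHS]tagnat.sig2K; apply/val_inj/eqP.
  by rewrite tagnat.eq_Rank; apply/andP; split; apply/eqP; first exact: val_inj.
pose w (i a : nat) : 'rV[K]_n.+1 := \row_l ((s1 l == i) && (s2 l == a))%:R.
have w_out i a : (nth 0 P i <= a)%N -> w i a = 0.
  move=> pa; apply/rowP => l; rewrite !mxE; case: eqP => //= li.
  by case: eqP => // la; have := s2P l; rewrite li la ltnNge pa.
have wB i a : w i a *m B = w i a.+1.
  apply/rowP => l; rewrite !mxE.
  have [/andP[/eqP li /eqP la]|nl] := boolP (_ && _); last first.
    rewrite big1 // => k _; rewrite !mxE BE -natrM mulnb.
    case: eqP => //= ki; case: eqP => //= ka.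
    by move: nl; rewrite -ki -ka eq_sym [s2 l == _]eq_sym => /negbTE->.
  have pi : (i < size P)%N by rewrite -li.
  have pa : (a < nth 0 P (Ordinal pi))%N by have := s2P l; rewrite li la /=; lia.
  pose k := cast_ord e (tagnat.Rank (Ordinal pi) (Ordinal pa)).
  have k12 : s1 k = i /\ s2 k = a.
    rewrite /s1 /s2 /k cast_ordK.
    pose R := @tagnat.Rank _ (fun i : 'I_(size P) => nth 0%N P i).
    rewrite -[tagnat.Rank _ _]/(R (Ordinal pi) (Ordinal pa)).
    by split; [rewrite tagnat.Rank1K | rewrite tagnat.Rank2K].
  rewrite (bigD1 k) //= big1 => [|k' kk'].
    by case: k12 => k1 k2; rewrite !mxE BE k1 k2 li la !eqxx mulr1 addr0.
  rewrite !mxE; case: eqP => /= [k1|]; last by rewrite mul0r.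
  by case: eqP => [k2|]; rewrite ?mul0r //; case/eqP: kk'; case: k12 => <- <- in k1 k2 *; apply: s12_inj.
have wX i a : w i 0%N *m B ^+ a = w i a.
  elim: a => [|a IH]; first by rewrite expr0 mulmx1.
  by rewrite exprSr -mulmxE mulmxA IH wB.
exists (w^~ 0%N); split=> [a|x]; first by rewrite wX w_out.
exists (fun a => \sum_(l | s1 l == a) x 0 l *: 'X^(s2 l)) => m Pm.
transitivity (\sum_l x 0 l *: w (s1 l) (s2 l)).
  rewrite {1}(row_sum_delta x); apply: eq_bigr => l _; congr (_ *: _).
  apply/rowP => l'; rewrite !mxE eqxx /=; congr ((nat_of_bool _)%:R); apply/eqP/andP => [->|[/eqP e1 /eqP e2]] //.
  exact: s12_inj.
have s1m l : (s1 l < m)%N by apply: leq_trans (s1P l) Pm.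
rewrite (partition_big (fun l => Ordinal (s1m l)) xpredT) //=.
apply: eq_bigr => a _; rewrite linear_sum mulmx_sumr /=.
apply: eq_big => [l|l /eqP <-]; first by rewrite -val_eqE.
by rewrite linearZ rmorphXn /= horner_mx_X -scalemxAr wX.
Qed.

(** Let [q] be the [i]-th part.  The rows [x *m B ^+ q] form a
    [K[B]]-module generated by [i] elements, as the strings from the [i]-th on
    are killed by [B ^+ q].  By Cayley-Hamilton over [{poly K}], applied to the
    [i] by [i] matrix of the action of [A] on these generators, a monic
    polynomial of degree [i] in [A] with coefficients in [K[B]] kills this
    module.  For [i >= size P] one has [q = 0]. *)
Lemma power_reduction (K : fieldType) (n : nat) (A B : 'M[K]_n.+1)
    (P : seq nat) (i : nat) : A * B = B * A -> sorted geq P ->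
    is_jordan_form B P ->
  exists g : nat -> {poly K}, A ^+ i * B ^+ nth 0%N P i =
    \sum_(m < i) A ^+ m * B ^+ nth 0%N P i * horner_mx B (g m).
Proof.
move=> commAB sP /jordan_form_generators[v [v0 vspan]].
set q := nth 0%N P i.
have vq a : (i <= a)%N -> v a *m B ^+ q = 0.
  move=> ia; have pq : (nth 0 P a <= q)%N.
    have [aP|Pa] := ltnP a (size P); last by rewrite nth_default.
    have geqtr : transitive geq by move=> x y z /= xy yz; apply: leq_trans yz xy.
    exact: (sorted_leq_nth geqtr leqnn 0%N sP i a (leq_ltn_trans ia aP) aP).
  by rewrite -(subnKC pq) exprD -mulmxE mulmxA v0 mul0mx.
have BqC p : horner_mx B p *m B ^+ q = B ^+ q *m horner_mx B p.
  by apply: commrX; apply: comm_horner_mx.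
have gens (x : 'rV_n.+1) : exists c : 'I_i -> {poly K},
    x *m B ^+ q = \sum_(a < i) v a *m B ^+ q *m horner_mx B (c a).
  have [c /(_ (i + size P)%N (leq_addl _ _)) xc] := vspan x.
  exists (fun a : 'I_i => c a); rewrite {1}xc mulmx_suml big_split_ord /=.
  rewrite [X in _ + X]big1 ?addr0 => [|a _]; last first.
    by rewrite -mulmxA BqC mulmxA vq ?mul0mx ?leq_addr.
  by apply: eq_bigr => a _; rewrite -mulmxA BqC mulmxA.
suff [g [g1 g0]] : exists g : nat -> {poly K}, g i = 1 /\
    forall x : 'rV_n.+1, x *m (\sum_(m < i.+1) B ^+ q * A ^+ m * horner_mx B (g m)) = 0.
  exists (fun m => - g m).
  have {}g0 : \sum_(m < i.+1) B ^+ q * A ^+ m * horner_mx B (g m) = 0.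
    by apply/row_matrixP => r; rewrite rowE g0 row0.
  have BqA m : B ^+ q * A ^+ m = A ^+ m * B ^+ q.
    exact/commrX/commr_sym/commrX.
  move: g0; rewrite big_ord_recr /= g1 rmorph1 mulr1 BqA => /eqP.
  rewrite addrC addr_eq0 => /eqP->; rewrite -sumrN; apply: eq_bigr => m _.
  by rewrite rmorphN mulrN BqA.
case: i @q vq gens BqC => [|i] q vq gens BqC.
  exists (fun=> 1); split=> // x; rewrite big_ord_recr big_ord0 /= add0r rmorph1 expr0 !mulr1.
  by have [c ->] := gens x; rewrite big_ord0.
have /fin_all_exists[S SP] : forall a : 'I_i.+1, exists c : 'I_i.+1 -> {poly K},
    v a *m A *m B ^+ q = \sum_(c' < i.+1) v c' *m B ^+ q *m horner_mx B (c c').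
  by move=> a; apply: gens.
pose M : 'M[{poly K}]_i.+1 := \matrix_(a, c) S a c.
have powM m (a : 'I_i.+1) : v a *m B ^+ q *m A ^+ m =
    \sum_(c < i.+1) v c *m B ^+ q *m horner_mx B ((M ^+ m) a c).
  elim: m => [|m IH].
    rewrite expr0 mulmx1 (bigD1 a) //= big1 ?addr0 => [|c ca].
      by rewrite mxE eqxx rmorph1 mulmx1.
    by rewrite mxE eq_sym (negbTE ca) rmorph0 mulmx0.
  rewrite exprSr -mulmxE mulmxA IH mulmx_suml.
  transitivity (\sum_(c < i.+1) \sum_(e < i.+1) v e *m B ^+ q *m horner_mx B ((M ^+ m) a c * S c e)).
    apply: eq_bigr => c _; rewrite -mulmxA.
    have -> : horner_mx B ((M ^+ m) a c) *m A = A *m horner_mx B ((M ^+ m) a c).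
      exact: comm_horner_mx.
    have -> : v c *m B ^+ q *m (A *m horner_mx B ((M ^+ m) a c)) =
        v c *m A *m B ^+ q *m horner_mx B ((M ^+ m) a c).
      rewrite !mulmxA -[v c *m _ *m A]mulmxA -[v c *m A *m _]mulmxA; congr (_ *m _ *m _).
      exact/commr_sym/commrX.
    rewrite SP mulmx_suml; apply: eq_bigr => e _.
    by rewrite -mulmxA mulmxE -rmorphM mulrC.
  rewrite exchange_big; apply: eq_bigr => e _ /=.
  by rewrite exprSr mxE raddf_sum /= mulmx_sumr; apply: eq_bigr => c _; rewrite mxE.
pose chi := char_poly M; exists (fun m => chi`_m); split=> [|x].
  by have := char_poly_monic M; rewrite monicE lead_coefE size_char_poly => /eqP.
have chi0 : \sum_(m < i.+2) chi`_m *: M ^+ m = 0.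
  apply: etrans (Cayley_Hamilton M); rewrite -/chi -[in RHS](coefK chi) poly_def.
  rewrite size_char_poly linear_sum; apply: eq_bigr => m _.
  by rewrite linearZ rmorphXn /= horner_mx_X.
pose T := \sum_(m < i.+2) A ^+ m * horner_mx B (chi`_m).
have TC p : horner_mx B p *m T = T *m horner_mx B p.
  rewrite mulmx_sumr mulmx_suml; apply: eq_bigr => m _.
  apply: commrM; last exact: comm_horner_mx2.
  by apply: commrX; apply: comm_horner_mx.
have vT a : v a *m B ^+ q *m T = 0 :> 'rV_n.+1.
  have [ai|ai] := ltnP a i.+1; last by rewrite vq // mul0mx.
  transitivity (\sum_(c < i.+1) v c *m B ^+ q *m
      horner_mx B ((\sum_(m < i.+2) chi`_m *: M ^+ m) (Ordinal ai) c)).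
    rewrite mulmx_sumr.
    under eq_bigr => m _ do rewrite -mulmxE mulmxA (powM m (Ordinal ai)) mulmx_suml.
    rewrite exchange_big; apply: eq_bigr => c _ /=.
    rewrite summxE raddf_sum mulmx_sumr; apply: eq_bigr => m _.
    by rewrite -mulmxA mulmxE -rmorphM mxE mulrC.
  by rewrite chi0 big1 // => c _; rewrite mxE rmorph0 mulmx0.
rewrite (_ : \sum_m _ = B ^+ q *m T); last first.
  by rewrite mulmx_sumr; apply: eq_bigr => m _; rewrite -mulrA.
have [c xc] := gens x; rewrite mulmxA xc mulmx_suml big1 // => a _.
by rewrite -mulmxA TC mulmxA vT mul0mx.
Qed.

(** * Algebras with two commuting generators *)

Lemma dim_quotv (K : fieldType) (V : vectType K) (U W : {vspace V}) :
  (W <= U)%VS -> \dim U = (\dim {: quotv U W} + \dim W)%N.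
Proof.
move=> WU; rewrite dimvf -(dimv_cap_compl U W) (capv_idPr WU) addnC.
by congr (_ + _)%N.
Qed.

Lemma bin_ffact_shift d s b : (b <= s <= d)%N ->
  ('C(d, s) * s ^_ b = d ^_ b * 'C(d - b, s - b))%N.
Proof.
case/andP=> bs sd; have bd := leq_trans bs sd.
apply/eqP; rewrite -(eqn_pmul2r (fact_gt0 (s - b))) -(eqn_pmul2r (fact_gt0 (d - s))).
rewrite -(mulnA 'C(d, s)) ffact_fact // -mulnA bin_fact // -!mulnA.
have -> : (d - s = (d - b) - (s - b))%N by lia.
by rewrite bin_fact ?ffact_fact //; lia.
Qed.

Lemma cofinite_common (T : eqType) (Q : nat -> T -> Prop) j :
    (forall d, (d <= j)%N -> exists r : seq T, forall x, x \notin r -> Q d x) ->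
  exists r : seq T, forall x, x \notin r -> forall d, (d <= j)%N -> Q d x.
Proof.
elim: j => [|j IH] Qd.
  by have [r rP] := Qd 0 isT; exists r => x xr d; rewrite leqn0 => /eqP->; apply: rP.
have [d dj|r rP] := IH; first by apply: Qd; apply: leqW.
have [r' rP'] := Qd j.+1 (leqnn _); exists (r ++ r') => x.
rewrite mem_cat negb_or => /andP[xr xr'] d; rewrite leq_eqVlt => /predU1P[->|].
  exact: rP'.
by rewrite ltnS; apply: rP.
Qed.

Lemma amull_pow (K : fieldType) (L : falgType K) (x y : L) k :
  lfun_pow (amull x) k y = x ^+ k * y.
Proof.
rewrite lfun_powE; elim: k => [|k IH]; first by rewrite mul1r.
by rewrite iterS IH lfunE /= mulrA -exprS.
Qed.

(** [L] is spanned by the words in [a] and [b], stated as an induction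
    principle. *)
Definition generated_by (K : fieldType) (L : falgType K) (a b : L) : Prop :=
  forall W : {vspace L}, 1 \in W ->
  (forall x, x \in W -> a * x \in W) -> (forall x, x \in W -> b * x \in W) ->
  W = fullv.

Definition two_gen_ideal (K : fieldType) (L : falgType K) (a b : L) :
  {vspace L} := ({:L} * <<[:: a; b]>>)%VS.

Section TwoGenerators.
Variables (K : fieldType) (L : falgType K) (a b : L).
Hypothesis ab : a * b = b * a.
Hypothesis gen_ind : generated_by a b.

Lemma gen_comm (x y : L) : x * y = y * x.
Proof.
have cen (c : L) : a * c = c * a -> b * c = c * b -> forall z, z * c = c * z.
  move=> ac bc z; apply/cent1vP; rewrite (_ : 'C[c]%VS = fullv) ?memvf //.
  apply: gen_ind => [|t|t]; first by apply/cent1vP; rewrite mul1r mulr1.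
    by move/cent1vP=> tc; apply/cent1vP; rewrite -mulrA tc !mulrA ac.
  by move/cent1vP=> tc; apply/cent1vP; rewrite -mulrA tc !mulrA bc.
by apply: (cen y); apply/esym/cen.
Qed.

Local Notation m := (two_gen_ideal a b).
Local Notation F := (ideal_pow m).

Lemma ideal_pow0 : F 0 = fullv.
Proof. by rewrite /ideal_pow expv0 prod1v. Qed.

Lemma ideal_pow_shift c x d : c \in m -> x \in F d -> c * x \in F d.+1.
Proof. by move=> cm xF; rewrite /ideal_pow expvSl -prodvA memv_mul. Qed.

Lemma gen1_in_ideal : a \in m.
Proof.
have aG : a \in <<[:: a; b]>>%VS by rewrite memv_span ?inE ?eqxx.
by have := memv_mul (memvf 1) aG; rewrite mul1r.
Qed.

Lemma gen2_in_ideal : b \in m.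
Proof.
have bG : b \in <<[:: a; b]>>%VS by rewrite memv_span ?inE ?eqxx ?orbT.
by have := memv_mul (memvf 1) bG; rewrite mul1r.
Qed.

Lemma ideal_pow_mull y x d : x \in F d -> y * x \in F d.
Proof.
move=> xF; rewrite gen_comm (subvP (_ : F d * {:L} <= F d)%VS) ?memv_mul ?memvf //.
by rewrite -prodvA prodvSr ?subvf.
Qed.

Lemma ideal_pow_exp c x t d : c \in m -> x \in F d -> c ^+ t * x \in F (t + d).
Proof.
move=> cm xF; elim: t => [|t IH]; first by rewrite mul1r.
by rewrite exprS -mulrA addSn ideal_pow_shift.
Qed.

Lemma ideal_pow_succ d : (F d.+1 <= amull a @: F d + amull b @: F d)%VS.
Proof.
rewrite /ideal_pow expvSl -prodvA -/(ideal_pow m d).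
apply/prodvP => x z xm zF.
suff : x \in (amulr z @^-1: (amull a @: F d + amull b @: F d))%VS.
  by rewrite -memv_preim lfunE.
move: x xm; apply/subvP/prodvP => y g _ gab.
suff /subvP/(_ g gab) : (<<[:: a; b]>> <=
    amulr (y * z) @^-1: (amull a @: F d + amull b @: F d))%VS.
  by rewrite -!memv_preim !lfunE /= (gen_comm y g) mulrA.
apply/span_subvP => c; rewrite !inE -memv_preim lfunE /=.
case/orP=> /eqP->; rewrite -[_ * _](lfunE (_ \*o idfun)).
  by rewrite (subvP (addvSl _ _)) // memv_img ?ideal_pow_mull.
by rewrite (subvP (addvSr _ _)) // memv_img ?ideal_pow_mull.
Qed.

Definition mono d s := a ^+ (d - s) * b ^+ s.

(** Since [L] is the sum of its scalars and of the ideal, the ideal power is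
    spanned by the monomials of degree [d] up to terms of higher degree. *)
Lemma ideal_pow_mono d : (F d <= <<mkseq (mono d) d.+1>> + F d.+1)%VS.
Proof.
elim: d => [|d IH].
  rewrite ideal_pow0 -(gen_ind (W := (<<mkseq (mono 0) 1>> + F 1)%VS)) ?subvv // => [|x _|x _].
  - rewrite (subvP (addvSl _ _)) // memv_span // mem_seq1 /mono /=.
    by rewrite !expr0 mulr1.
  - by rewrite (subvP (addvSr _ _)) // ideal_pow_shift ?gen1_in_ideal // ideal_pow0 memvf.
  - by rewrite (subvP (addvSr _ _)) // ideal_pow_shift ?gen2_in_ideal // ideal_pow0 memvf.
apply: subv_trans (ideal_pow_succ d) _; rewrite subv_add.
apply/andP; split; apply: subv_trans (limgS _ IH) _; rewrite limgD addvS //.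
- rewrite limg_span; apply/span_subvP => _ /mapP[_ /mapP[s sd ->] ->].
  rewrite mem_iota add0n ltnS in sd; apply/memv_span/mapP; exists s.
    by rewrite mem_iota; lia.
  by rewrite lfunE /= /mono mulrA -exprS subSn.
- by apply/subvP => _ /memv_imgP[x xF ->]; rewrite lfunE ideal_pow_shift ?gen1_in_ideal.
- rewrite limg_span; apply/span_subvP => _ /mapP[_ /mapP[s sd ->] ->].
  rewrite mem_iota add0n ltnS in sd; apply/memv_span/mapP; exists s.+1.
    by rewrite mem_iota; lia.
  by rewrite lfunE /= /mono (gen_comm b) -mulrA -exprSr subSS.
- by apply/subvP => _ /memv_imgP[x xF ->]; rewrite lfunE ideal_pow_shift ?gen2_in_ideal.
Qed.

(** If [x] is in the [d]-th power, then [a ^+ i * b ^+ k * x] is a sum of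
    terms divisible by monomials of degree at least [i + k + d], by
    [ideal_pow_succ]; a monomial of degree at least [p + q] vanishes. *)
Lemma ideal_pow_nilp p q : a ^+ p = 0 -> b ^+ q = 0 -> F (p + q) = 0%VS.
Proof.
move=> ap bq; apply/eqP; rewrite -subv0; apply/subvP => x xF.
have gt0 (c : L) r i : c ^+ r = 0 -> (r <= i)%N -> c ^+ i = 0.
  by move=> cr ri; rewrite -(subnK ri) exprD cr mulr0.
suff kill d i k y : y \in F d -> (p + q <= i + k + d)%N -> a ^+ i * b ^+ k * y = 0.
  by have := kill _ 0 0 x xF (leqnn _); rewrite !expr0 !mul1r => ->; rewrite mem0v.
elim: d i k y => [|d IH] i k y yF le_pq.
  have [pi|ip] := leqP p i; first by rewrite (gt0 a p) // !mul0r.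
  by rewrite (gt0 b q) ?mulr0 ?mul0r //; lia.
have /subvP/(_ y yF)/memv_addP[_ /memv_imgP[y1 y1F ->]] := ideal_pow_succ d.
case=> _ /memv_imgP[y2 y2F ->] ->; rewrite !lfunE /= mulrDr !mulrA.
rewrite -(mulrA _ _ a) (gen_comm _ a) mulrA -exprSr (IH i.+1) ?add0r //; last lia.
by rewrite -(mulrA _ _ b) -exprSr (IH i k.+1) //; lia.
Qed.

Local Notation h := (hilbert m).

Lemma dim_ideal_pow d : \dim (F d) = (h d + \dim (F d.+1))%N.
Proof. exact/dim_quotv/ideal_powS. Qed.

Lemma hilbert_le d : (h d <= d.+1)%N.
Proof.
have := dimvS (ideal_pow_mono d); rewrite dim_ideal_pow => le1.
have [le2 _] := dimv_add_leqif <<mkseq (mono d) d.+1>> (F d.+1).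
have := dim_span (mkseq (mono d) d.+1); rewrite size_mkseq => le3.
by rewrite -(leq_add2r (\dim (F d.+1))) (leq_trans le1) // (leq_trans le2) ?leq_add2r.
Qed.

(** Beyond the socle degree the dimensions of the powers are constant, hence
    zero by nilpotency. *)
Lemma ideal_pow_socle j : is_socle_degree m j ->
  (exists p, a ^+ p = 0) -> (exists q, b ^+ q = 0) -> F j.+1 = 0%VS.
Proof.
case=> _ hj [p ap] [q bq]; apply/eqP; rewrite -dimv_eq0.
have dimE t : \dim (F j.+1) = \dim (F (j.+1 + t)).
  elim: t => [|t ->]; first by rewrite addn0.
  by rewrite dim_ideal_pow addnS hj //; lia.
have F_le t : (F (p + q + t) <= F (p + q))%VS.
  elim: t => [|t IH]; first by rewrite addn0.
  by rewrite addnS (subv_trans (ideal_powS _ _)).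
have := F_le j.+1; rewrite (ideal_pow_nilp ap bq) subv0 addnC => /eqP e.
by rewrite (dimE (p + q)%N) e dimv0.
Qed.

Local Notation cls d := (linfun (gr_class m d) : 'Hom(L, gr_piece m d)).

Lemma gr_class_linE d x : cls d x = gr_class m d x.
Proof. exact: (lfunE (quot_class (ideal_pow m d) (ideal_pow m d.+1))). Qed.

Lemma gr_class_eq0 d x : x \in F d -> (cls d x == 0) = (x \in F d.+1).
Proof. by move=> xF; rewrite gr_class_linE quot_class_eq0 ?ideal_powS. Qed.

Lemma gr_class_onto d : (cls d @: F d = fullv)%VS.
Proof.
apply/vspaceP => y; rewrite memvf -(quot_reprK y) -[quot_class _ _]/(gr_class m d).
by rewrite -gr_class_linE memv_img // quot_repr_mem.
Qed.

Lemma span_class_mono d : (<<mkseq (fun s => cls d (mono d s)) d.+1>> = fullv)%VS.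
Proof.
apply/eqP; rewrite eqEsubv subvf /= -(gr_class_onto d).
apply: subv_trans (limgS _ (ideal_pow_mono d)) _.
rewrite limgD limg_span -map_comp subv_add subvv /=.
apply/subvP => _ /memv_imgP[x xF ->].
have /eqP-> : cls d x == 0 by rewrite gr_class_eq0 // (subvP (ideal_powS m d)).
exact: mem0v.
Qed.

(** The identity says that the [c]-th derivative of
    [lam |-> (a + lam *: b) ^+ d] is a multiple of
    [b ^+ c * (a + lam *: b) ^+ (d - c)]. *)
Lemma osculating_mono (lam : K) d c : (c <= d)%N ->
  \sum_(s < d.+1) ('C(d, s) * s ^_ c)%:R * lam ^+ s *: mono d s =
    ((d ^_ c)%:R * lam ^+ c) *: (b ^+ c * (a + lam *: b) ^+ (d - c)).
Proof.
move=> cd; rewrite -(big_mkord xpredT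
  (fun s => ('C(d, s) * s ^_ c)%:R * lam ^+ s *: mono d s)).
rewrite (@big_cat_nat _ _ _ c) //=; last exact: leqW.
rewrite big_nat_cond big1 ?add0r => [|s]; last first.
  by case/andP=> /andP[_ sc] _; rewrite ffact_small // muln0 mul0r scale0r.
rewrite -{1}(add0n c) big_addn subSn // big_mkord exprDn_comm; last first.
  by rewrite /GRing.comm -scalerAr -scalerAl ab.
rewrite mulr_sumr scaler_sumr; apply: eq_bigr => t _.
have td : (t <= d - c)%N by have := ltn_ord t; lia.
rewrite /mono exprZn -scaler_nat -!scalerAr !scalerA.
have -> : (d - (t + c) = d - c - t)%N by lia.
rewrite bin_ffact_shift ?addnK; last lia.
congr (_ *: _); last by rewrite mulrA (gen_comm (b ^+ c)) -mulrA -exprD addnC.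
by rewrite natrM exprD [lam ^+ t * _]mulrC mulrACA.
Qed.

(** Modulo [b ^+ k], a monomial [a ^+ i * b ^+ e] with [e >= nth 0 P i]
    reduces to monomials with a smaller exponent of [a]; the irreducible ones
    have [i < size P] and [e < minn (nth 0 P i) k]. *)
Lemma dim_pow_coker_le (P : seq nat) k :
    (exists p, a ^+ p = 0) -> (exists q, b ^+ q = 0) ->
    (forall i, exists g : nat -> {poly K}, a ^+ i * b ^+ nth 0%N P i =
       \sum_(t < i) \sum_(s < size (g t))
         (g t)`_s *: (a ^+ t * b ^+ (nth 0%N P i + s))) ->
  (\dim {:L} <= \sum_(p <- P) minn p k + \dim (limg (lfun_pow (amull b) k)))%N.
Proof.
move=> [p ap] [q bq] red.
pose S := [seq a ^+ i * b ^+ e | i <- iota 0 (size P), e <- iota 0 (minn (nth 0%N P i) k)].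
pose Y := (<<S>> + limg (lfun_pow (amull b) k))%VS.
have sizeS : size S = (\sum_(p <- P) minn p k)%N.
  rewrite size_allpairs_dep sumnE big_map [RHS](big_nth 0%N) /index_iota subn0.
  by apply: eq_bigr => i _; rewrite size_iota.
have memY i : forall e, a ^+ i * b ^+ e \in Y.
  elim/ltn_ind: i => i IH e.
  have [ke|ek] := leqP k e.
    rewrite (subvP (addvSr _ _)) // -(subnKC ke) exprD gen_comm -mulrA -amull_pow.
    by rewrite memv_img ?memvf.
  have [pe|ep] := leqP (nth 0%N P i) e.
    have [g gE] := red i.
    rewrite -(subnKC pe) exprD mulrA gE mulr_suml rpred_sum // => t _.
    rewrite mulr_suml rpred_sum // => s _.
    by rewrite -scalerAl rpredZ // -mulrA -exprD IH.
  have iP : (i < size P)%N by rewrite ltnNge; apply: contraL ep => /(nth_default 0%N)->.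
  rewrite (subvP (addvSl _ _)) // memv_span //.
  by apply/allpairsPdep; exists i, e; rewrite !mem_iota leq_min ep ek.
(* Nilpotency makes the span of all monomials the span of finitely many. *)
pose SW := [seq a ^+ i * b ^+ e | i <- iota 0 p.+1, e <- iota 0 q.+1].
pose W := <<SW>>%VS.
have memW i e : a ^+ i * b ^+ e \in W.
  have [pi|ip] := ltnP p i; first by rewrite -(subnKC (ltnW pi)) exprD ap !mul0r mem0v.
  have [qe|eq_] := ltnP q e; first by rewrite -(subnKC (ltnW qe)) exprD bq mul0r mulr0 mem0v.
  by apply/memv_span/allpairsPdep; exists i, e; rewrite !mem_iota !ltnS.
have stableW c : (forall i e, c * (a ^+ i * b ^+ e) \in W) -> forall x, x \in W -> c * x \in W.
  move=> cW; suff /subvP WW : (W <= amull c @^-1: W)%VS.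
    by move=> x /WW; rewrite -memv_preim lfunE.
  apply/span_subvP => _ /allpairsPdep[i [e [_ _ ->]]].
  by rewrite -memv_preim lfunE cW.
have WY : (fullv <= Y)%VS.
  rewrite -(gen_ind (W := W)).
  - by apply/span_subvP => _ /allpairsPdep[i [e [_ _ ->]]].
  - by have := memW 0 0; rewrite !expr0 mulr1.
  - by apply: stableW => i e; rewrite mulrA -exprS.
  - by apply: stableW => i e; rewrite (gen_comm b) -mulrA -exprSr.
apply: leq_trans (dimvS WY) _; have [le2 _] := dimv_add_leqif <<S>> (limg (lfun_pow (amull b) k)).
by apply: leq_trans le2 _; rewrite leq_add2r -sizeS dim_span.
Qed.

End TwoGenerators.

(** The classes of the monomials of degree [d = i + k] span
    [F_d / F_{d+1}], where [F] is the filtration by the powers of the ideal,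
    and by [osculating_mono] the derivatives of order [c <= i] of the class of
    [(a + lam *: b) ^+ d] lie in the image of [(a + lam *: b) ^+ k]; generically
    as many of them as possible are independent. *)
Lemma generic_lefschetz (K : closedFieldType) (L : falgType K) (a b : L) j :
    a * b = b * a -> generated_by a b ->
    (forall t, (0 < t <= j)%N -> t%:R != 0 :> K) ->
  exists r : seq K, forall lam, lam \notin r -> forall i k, (i + k <= j)%N ->
    (minn (hilbert (two_gen_ideal a b) (i + k)) i.+1 <=
     \dim (linfun (gr_class (two_gen_ideal a b) (i + k)) @:
       (lfun_pow (amull (a + lam *: b)) k @: ideal_pow (two_gen_ideal a b) i)))%N.
Proof.
move=> ab gen charj; set m := two_gen_ideal a b; pose h := hilbert m.
pose cls d : 'Hom(L, gr_piece m d) := linfun (gr_class m d).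
pose u d s := cls d (mono a b d s).
have [d dj|r rP] := @cofinite_common K (fun d lam =>
    free [seq osculating (u d) d lam c | c <- iota 0 (h d)]) j.
  have [t td|r rP] := @osculating_free K _ (u d) d.
    by apply: charj; lia.
  by exists r => lam /rP; rewrite (span_class_mono ab gen).
exists r => lam /rP{}rP i k ikj; set d := (i + k)%N.
set l := a + lam *: b; set W := (_ @: _)%VS.
set q := minn _ _.
have : free [seq osculating (u d) d lam c | c <- iota 0 q].
  have := rP d ikj; rewrite -{1}(subnKC (geq_minl (h d) i.+1)) -/q iotaD map_cat.
  exact: catl_free.
rewrite /free => /eqP dimq; have {1}-> : q = size [seq osculating (u d) d lam c | c <- iota 0 q].
  by rewrite size_map size_iota.
rewrite -dimq dimvS //; apply/span_subvP => _ /mapP[c cq ->].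
have ci : (c <= i)%N by move: cq; rewrite mem_iota /q; lia.
have -> : osculating (u d) d lam c =
    cls d (((d ^_ c)%:R * lam ^+ c) *: (b ^+ c * l ^+ (d - c))).
  rewrite -(osculating_mono ab gen); last by rewrite /d; lia.
  by rewrite linear_sum; apply: eq_bigr => s _; rewrite linearZ.
rewrite linearZ /= memvZ // memv_img //.
have -> : b ^+ c * l ^+ (d - c) = lfun_pow (amull l) k (b ^+ c * l ^+ (i - c)).
  rewrite amull_pow mulrA (gen_comm ab gen (l ^+ k)) -mulrA -exprD.
  by congr (_ * _ ^+ _); rewrite /d; lia.
have lm : l \in m by rewrite rpredD ?rpredZ ?gen1_in_ideal ?gen2_in_ideal.
have lF : l ^+ (i - c) \in ideal_pow m (i - c).
  have := ideal_pow_exp (i - c) (d := 0) lm (x := 1); rewrite mulr1 addn0; apply.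
  by rewrite ideal_pow0 memvf.
by have := ideal_pow_exp c (gen2_in_ideal a b) lF; rewrite subnKC // => /memv_img->.
Qed.

(** * The associated graded algebra *)

(** Restrict [f] to [X + Y]: its kernel contains [Y]. *)
Lemma dim_add_ker_ge (K : fieldType) (V W : vectType K) (f : 'Hom(V, W))
    (X Y : {vspace V}) : (Y <= lker f)%VS ->
  (\dim (f @: X) + \dim Y <= \dim (X + Y))%N.
Proof.
move=> Yk; rewrite -(limg_ker_dim f (X + Y)) addnC leq_add //.
  by rewrite dimvS // subv_cap addvSr.
by rewrite dimvS // limgS ?addvSl.
Qed.

Definition dsum_proj (K : fieldType) (N : nat) (T : 'I_N -> vectType K) (i : 'I_N)
  (u : dsum T) : T i := u i.

Lemma dsum_proj_is_linear (K : fieldType) (N : nat) (T : 'I_N -> vectType K) i :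
  linear (@dsum_proj K N T i).
Proof. by move=> c u v; rewrite /dsum_proj dsumD dsumZ. Qed.
HB.instance Definition _ (K : fieldType) (N : nat) (T : 'I_N -> vectType K) i :=
  GRing.isLinear.Build K (dsum T) (T i) _ (@dsum_proj K N T i)
    (@dsum_proj_is_linear K N T i).

Section GradedFiltration.
Variables (K : fieldType) (L : falgType K) (m : {vspace L}) (j : nat).

(** The class of [x] in the component of degree [d]; it is zero for
    [d > j]. *)
Definition gr_hom d (x : L) : gr m j :=
  dsum_of (fun k : 'I_j.+1 => if k == d :> nat then gr_class m k x else 0).

Let proj (k : 'I_j.+1) : 'Hom(gr m j, gr_piece m k) := linfun (@dsum_proj K _ (fun i : 'I_j.+1 => gr_piece m i) k).

Definition gr_filt d : {vspace gr m j} := (\bigcap_(k < j.+1 | (k < d)%N) lker (proj k))%VS.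

Lemma gr_filtP d (u : gr m j) : reflect (forall k : 'I_j.+1, (k < d)%N -> u k = 0) (u \in gr_filt d).
Proof.
apply: (iffP subv_bigcapP) => uk k kd.
  by have := uk k kd; rewrite -memvE memv_ker lfunE => /eqP.
by rewrite -memvE memv_ker lfunE; apply/eqP/uk.
Qed.

Lemma gr_filt0 : gr_filt 0 = fullv.
Proof. by apply/vspaceP => u; rewrite memvf; apply/gr_filtP. Qed.

Lemma gr_filt_out d : (j < d)%N -> gr_filt d = 0%VS.
Proof.
move=> jd; apply/vspaceP => u; rewrite memv0; apply/gr_filtP/eqP => [u0|->].
  by apply/dsumP => k; rewrite u0 ?dsum_ofE //; have := ltn_ord k; lia.
by move=> k _; rewrite dsum_ofE.
Qed.

Lemma gr_filt_dec d : (gr_filt d.+1 <= gr_filt d)%VS.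
Proof. by apply/subvP => u /gr_filtP uk; apply/gr_filtP => k kd; apply/uk/leqW. Qed.

Lemma gr_hom_filt d x : gr_hom d x \in gr_filt d.
Proof. by apply/gr_filtP => k kd; rewrite dsum_ofE ltn_eqF. Qed.

Lemma dim_gr_filt (d : 'I_j.+1) : \dim (gr_filt d) = (hilbert m d + \dim (gr_filt d.+1))%N.
Proof.
have onto : (proj d @: gr_filt d = fullv)%VS.
  apply/vspaceP => y; rewrite memvf -(quot_reprK y).
  apply/memv_imgP; exists (gr_hom d (quot_repr y)); first exact: gr_hom_filt.
  by rewrite lfunE /= /dsum_proj dsum_ofE eqxx.
have kerE : (gr_filt d :&: lker (proj d) = gr_filt d.+1)%VS.
  apply/vspaceP => u; rewrite memv_cap memv_ker lfunE.
  apply/andP/gr_filtP => [[/gr_filtP uk /eqP ud] k|uk].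
    by rewrite ltnS leq_eqVlt => /predU1P[/val_inj->|/uk].
  by split; [apply/gr_filtP => k kd; apply/uk/leqW | apply/eqP/uk].
by rewrite /hilbert -onto -kerE addnC limg_ker_dim.
Qed.

End GradedFiltration.

Section GradedMultiplication.
Variables (K : fieldType) (L : falgType K) (m : {vspace L}) (j : nat) (l : L).
Hypothesis m_ideal : ({:L} * m <= m)%VS.
Hypothesis l_in : l \in ideal_pow m 1.

Local Notation gr_hom := (gr_hom m j).
Local Notation gr_filt := (gr_filt m j).
Let proj (k : 'I_j.+1) : 'Hom(gr m j, gr_piece m k) :=
  linfun (@dsum_proj K _ (fun i : 'I_j.+1 => gr_piece m i) k).
Let f := gr_amull (gr_deg1 m j l).

Lemma gr_repr0 d : @gr_repr K L m d 0 = 0.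
Proof. exact: linear0. Qed.

Lemma gr_class0 d : gr_class m d 0 = 0.
Proof. exact: linear0. Qed.

Lemma gr_amull_deg1E (u : gr m j) (k : 'I_j.+1) :
  f u k = \sum_(i < j.+1 | i == 1%N :> nat) \sum_(t < j.+1 | (i + t == k)%N)
    gr_class m k (gr_repr (gr_class m i l) * gr_repr (u t)).
Proof.
rewrite lfunE dsum_ofE [RHS]big_mkcond; apply: eq_bigr => i _ /=.
rewrite dsum_ofE; case: ifP => // _.
by rewrite big1 // => t _; rewrite gr_repr0 mul0r gr_class0.
Qed.

Lemma gr_amull_hom d x : x \in ideal_pow m d ->
  f (gr_hom d x) = gr_hom d.+1 (l * x).
Proof.
move=> xF; apply/dsumP => k; rewrite gr_amull_deg1E !dsum_ofE.
have mulE (i t : nat) : i = 1%N -> t = d -> (i + t == k)%N ->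
    gr_class m k (gr_repr (gr_class m i l) * gr_repr (gr_class m t x)) =
    gr_class m k (l * x).
  by move=> -> -> /eqP <-; apply: gr_class_mul.
case: eqP => [kd|kd].
  have j1 : (1 < j.+1)%N by have := ltn_ord k; lia.
  have jd : (d < j.+1)%N by have := ltn_ord k; lia.
  rewrite (bigD1 (Ordinal j1)) //= (bigD1 (Ordinal jd)) /=; last by rewrite kd.
  rewrite dsum_ofE eqxx mulE ?kd // big1 => [|t /andP[ktd /eqP td]]; last first.
    rewrite dsum_ofE; case: eqP => [e|_]; last by rewrite gr_repr0 mulr0 gr_class0.
    by case: td; apply: val_inj.
  rewrite big1 ?addr0 // => i /andP[/eqP i1 /eqP ni].
  by case: ni; apply: val_inj.
rewrite big1 // => i /eqP i1; rewrite big1 // => t /eqP it.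
rewrite dsum_ofE; case: eqP => [e|_]; last by rewrite gr_repr0 mulr0 gr_class0.
by case: kd; rewrite -it i1 e.
Qed.

Lemma gr_amull_pow_hom d k x : x \in ideal_pow m d ->
  lfun_pow f k (gr_hom d x) = gr_hom (d + k) (l ^+ k * x).
Proof.
rewrite lfun_powE => xF.
suff [] : iter k f (gr_hom d x) = gr_hom (d + k) (l ^+ k * x) /\
   l ^+ k * x \in ideal_pow m (d + k) by [].
elim: k => [|k [IH lF]]; first by rewrite mul1r addn0.
rewrite iterS IH gr_amull_hom // exprS -mulrA addnS; split=> //.
exact: (subvP (ideal_powM 1 (d + k) m_ideal)) _ (memv_mul l_in lF).
Qed.

Lemma gr_filt_shift d : (f @: gr_filt d <= gr_filt d.+1)%VS.
Proof.
apply/subvP => _ /memv_imgP[u /gr_filtP uk ->]; apply/gr_filtP => k kd.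
rewrite gr_amull_deg1E big1 // => i /eqP i1; rewrite big1 // => t /eqP it.
by rewrite uk ?gr_repr0 ?mulr0 ?gr_class0 //; lia.
Qed.

(** On homogeneous elements the multiplication of the graded algebra is
    induced by the one of [L], so the rank on [L] bounds the rank here. *)
Lemma gr_filt_rank i k : (i + k <= j)%N ->
  (\dim (linfun (gr_class m (i + k)) @: (lfun_pow (amull l) k @: ideal_pow m i)) +
     \dim (gr_filt (i + k).+1) <=
   \dim (lfun_pow f k @: gr_filt i + gr_filt (i + k).+1))%N.
Proof.
rewrite -ltnS => ikj; pose d := Ordinal ikj.
have kerd : (gr_filt (i + k).+1 <= lker (proj d))%VS.
  by apply/subvP => u /gr_filtP/(_ d (leqnn _)) ud; rewrite memv_ker lfunE; apply/eqP.
apply: leq_trans (dim_add_ker_ge _ kerd); rewrite leq_add2r dimvS //.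
apply/subvP => _ /memv_imgP[_ /memv_imgP[x xF ->] ->].
rewrite amull_pow.
have <- : proj d (lfun_pow f k (gr_hom i x)) =
    linfun (gr_class m (i + k)) (l ^+ k * x).
  rewrite gr_amull_pow_hom // lfunE /= /dsum_proj dsum_ofE eqxx.
  exact/esym/(lfunE (quot_class (ideal_pow m (i + k)) (ideal_pow m (i + k).+1))).
by rewrite !memv_img ?gr_hom_filt.
Qed.

End GradedMultiplication.

(** * The algebra of a pair of commuting nilpotent matrices *)

Lemma notin_seq_exists (K : closedFieldType) (r : seq K) : exists x, x \notin r.
Proof.
have /closed_nonrootP[x] : \prod_(z <- r) ('X - z%:P) != 0 :> {poly K}.
  exact/monic_neq0/monic_prod_XsubC.
by rewrite root_prod_XsubC; exists x.
Qed.

Lemma natr_neq0_of_char (K : idomainType) j t :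
    [pchar K] =i pred0 \/ (exists2 p, p \in [pchar K] & (j < p)%N) ->
  (0 < t <= j)%N -> t%:R != 0 :> K.
Proof.
case=> [/pcharf0P charK|[p charK jp]] tj; first by rewrite charK; lia.
by rewrite -(dvdn_pcharf charK); apply/negP => /dvdn_leq; lia.
Qed.

Section TwoGeneratorsJordan.
Variables (K : closedFieldType) (L : falgType K) (a b : L) (j : nat).
Hypothesis ab : a * b = b * a.
Hypothesis gen_ind : generated_by a b.
Hypotheses (nil_a : exists p, a ^+ p = 0) (nil_b : exists q, b ^+ q = 0).
Local Notation m := (two_gen_ideal a b).
Hypothesis socj : is_socle_degree m j.
Hypothesis charj : forall t, (0 < t <= j)%N -> t%:R != 0 :> K.

Let Q := hilbert_partition m j.

Let QE : Q = dual_partition (mkseq (hilbert m) j.+1).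
Proof. exact: dual_partition_sort. Qed.

Let m_ideal : ({:L} * m <= m)%VS.
Proof. by rewrite /two_gen_ideal prodvA prodvSl ?subvf. Qed.

Let m_shift c d : c \in m -> (amull c @: ideal_pow m d <= ideal_pow m d.+1)%VS.
Proof.
move=> cm; apply/subvP => _ /memv_imgP[x xF ->].
by rewrite lfunE ideal_pow_shift.
Qed.

Let Fj : ideal_pow m j.+1 = 0%VS.
Proof. exact: (ideal_pow_socle ab gen_ind). Qed.

Let h_le := hilbert_le ab gen_ind.

Let lefschetz_in l := forall i k, (i + k <= j)%N ->
  (minn (hilbert m (i + k)) i.+1 <= \dim (linfun (gr_class m (i + k)) @:
     (lfun_pow (amull l) k @: ideal_pow m i)))%N.

Let filtered l : lefschetz_in l -> forall i k, (i + k <= j)%N ->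
  (minn (hilbert m (i + k)) i.+1 + \dim (ideal_pow m (i + k).+1) <=
   \dim (lfun_pow (amull l) k @: ideal_pow m i + ideal_pow m (i + k).+1))%N.
Proof.
move=> lef i k ikj; apply: leq_trans (dim_add_ker_ge (f := linfun (gr_class m (i + k))) _ _).
  by rewrite leq_add2r lef.
apply/subvP => x xF; rewrite memv_ker gr_class_eq0 //.
by rewrite (subvP (ideal_powS _ _)).
Qed.

Lemma jordan_type_amull l : l \in m -> lefschetz_in l -> has_jordan_type (amull l) Q.
Proof.
move=> lm lef; rewrite QE.
apply: (jordan_type_filtered (ideal_pow0 a b) Fj (ideal_powS m) (fun i => m_shift i lm)
  (dim_ideal_pow a b) h_le (filtered lef)).
Qed.

Lemma jordan_type_gr_amull l : l \in m -> lefschetz_in l ->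
  has_jordan_type (gr_amull (gr_deg1 m j l)) Q.
Proof.
move=> lm lef; rewrite QE.
have l1 : l \in ideal_pow m 1 by rewrite /ideal_pow expv1 -[l]mulr1 memv_mul ?memvf.
have [_ h0] := socj.
have dimG i : \dim (@gr_filt K L m j i) = (hilbert m i + \dim (@gr_filt K L m j i.+1))%N.
  have [ij|ji] := ltnP i j.+1; first exact: (@dim_gr_filt K L m j (Ordinal ij)).
  by rewrite !gr_filt_out ?dimv0 ?h0 //; lia.
apply: (jordan_type_filtered (gr_filt0 m j) (gr_filt_out m (ltnSn j))
  (@gr_filt_dec K L m j) (gr_filt_shift j m_ideal l1) dimG h_le) => i k ikj.
apply: leq_trans (gr_filt_rank m_ideal l1 ikj).
by rewrite leq_add2r lef.
Qed.

Lemma exists_generic_lefschetz :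
  exists r : seq K, forall lam, lam \notin r -> lefschetz_in (a + lam *: b).
Proof. exact: generic_lefschetz. Qed.

(** A generic element of the pencil provides the growth condition on the
    Hilbert function; the bound for [b] is then [rank_pow_le]. *)
Lemma rank_pow_gen_le k : (\dim (limg (lfun_pow (amull b) k)) <= excess k Q)%N.
Proof.
rewrite QE; apply: (rank_pow_le (ideal_pow0 a b) Fj (ideal_powS m) (fun i => m_shift i (gen2_in_ideal a b))
  (dim_ideal_pow a b) h_le).
have [r rP] := exists_generic_lefschetz; have [lam /rP lef] := notin_seq_exists r.
have lm : a + lam *: b \in m by rewrite rpredD ?rpredZ ?gen1_in_ideal ?gen2_in_ideal.
exact: (lefschetz_growth Fj (ideal_powS m) (fun i => m_shift i lm)
  (dim_ideal_pow a b) (filtered lef)).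
Qed.

End TwoGeneratorsJordan.

Section PairAlgebraGenerators.
Variables (K : fieldType) (n : nat) (A B : 'M[K]_n.+1).
Local Notation L := (pair_alg A B).
Local Notation a := (in_pair_alg A B A).
Local Notation b := (in_pair_alg A B B).

Lemma mem_pair_gens : (A \in pair_aspace A B) /\ (B \in pair_aspace A B).
Proof.
split; last exact: (mem_pencil A B None).
by have := mem_pencil A B (Some 0); rewrite scale0r addr0.
Qed.

Lemma val_gen : (vsval a = A) * (vsval b = B).
Proof. by have [AP BP] := mem_pair_gens; rewrite !pair_aspaceP. Qed.

Lemma vsval_pairM (x y : L) : vsval (x * y) = vsval x * vsval y.
Proof. by []. Qed.

Lemma vsval_pair1 : vsval (1 : L) = 1.
Proof.
apply/eqP; rewrite (algid_eq1 (pair_aspace A B)).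
by have := sub1_agenv (1 + <<[:: A; B]>>)%VS; rewrite -memvE.
Qed.

Lemma vsval_pairX (x : L) k : vsval (x ^+ k) = vsval x ^+ k.
Proof. by elim: k => [|k IH]; rewrite ?vsval_pair1 // !exprS vsval_pairM IH. Qed.

Lemma pair_alg_generated : generated_by a b.
Proof.
move=> W W1 aW bW; pose iota : 'Hom(L, 'M[K]_n.+1) := linfun (@vsval K _ (pair_aspace A B)).
have iotaE x : iota x = vsval x by exact: lfunE.
have sub : (pair_aspace A B <= iota @: W)%VS.
  apply: agenv_sub_modl; first by rewrite -memvE -vsval_pair1 -iotaE memv_img.
  apply/prodvP => _ y /memv_addP[_ /vlineP[c ->] [g gAB ->]] /memv_imgP[x xW ->].
  rewrite mulrDl -scalerAl mul1r rpredD ?rpredZ ?memv_img //.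
  suff /subvP/(_ g gAB) : (<<[:: A; B]>> <= amulr (iota x) @^-1: (iota @: W))%VS.
    by rewrite -memv_preim lfunE.
  apply/span_subvP => M; rewrite !inE -memv_preim lfunE /= iotaE.
  case/orP=> /eqP->.
    by rewrite -{1}val_gen.1 -vsval_pairM -iotaE memv_img ?aW.
  by rewrite -{1}val_gen.2 -vsval_pairM -iotaE memv_img ?bW.
apply/vspaceP => x; rewrite memvf.
have /memv_imgP[y yW] := subvP sub _ (subvsP x).
by rewrite iotaE => /subvs_inj->.
Qed.

End PairAlgebraGenerators.

Theorem theorem2p16 (K : closedFieldType) (n : nat) (A B : 'M[K]_n.+1)
    (P : seq nat) (j : nat)
    (nilA : exists k, A ^+ k = 0) (nilB : exists k, B ^+ k = 0)
    (commAB : A * B = B * A)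
    (partP : is_partition n.+1 P) (jordanB : is_jordan_form B P)
    (dimAB : \dim (pair_aspace A B) = n.+1)
    (socj : is_socle_degree (max_ideal A B) j)
    (charK : [pchar K] =i pred0 \/ exists2 p, p \in [pchar K] & (j < p)%N) :
  (exists s : seq (option K), forall l : option K, l \notin s ->
     has_jordan_type (amull (pencil A B l))
       (hilbert_partition (max_ideal A B) j) /\
     has_jordan_type (gr_amull (gr_deg1 (max_ideal A B) j (pencil A B l)))
       (hilbert_partition (max_ideal A B) j)) /\
  majorizes (hilbert_partition (max_ideal A B) j) P.
Proof.
pose a := in_pair_alg A B A; pose b := in_pair_alg A B B.
have ab : a * b = b * a by apply: subvs_inj; rewrite !vsval_pairM !val_gen.
have gen_ind := @pair_alg_generated K n A B.
have nil_a : exists p, a ^+ p = 0.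
  by have [p Ap] := nilA; exists p; apply: subvs_inj; rewrite vsval_pairX val_gen.
have nil_b : exists q, b ^+ q = 0.
  by have [q Bq] := nilB; exists q; apply: subvs_inj; rewrite vsval_pairX val_gen.
have charj t := natr_neq0_of_char (t := t) charK.
have [/= sP _ /eqP sumP] := and3P partP.
split.
  have [r rP] := exists_generic_lefschetz ab gen_ind charj.
  exists (None :: map Some r) => -[c|]; rewrite inE // (mem_map Some_inj) /= => /rP lef.
  have penE : pencil A B (Some c) = a + c *: b.
    apply: subvs_inj; rewrite /pencil pair_aspaceP ?(mem_pencil A B (Some c)) //.
    by rewrite linearD linearZ /= !val_gen.
  have lm : a + c *: b \in max_ideal A B.
    rewrite /max_ideal -[_ + _]mul1r memv_mul ?memvf //.
    by rewrite rpredD ?rpredZ // memv_span // !inE eqxx ?orbT.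
  rewrite penE; split; first exact: (jordan_type_amull ab gen_ind nil_a nil_b socj lm lef).
  exact: (jordan_type_gr_amull ab gen_ind socj lm lef).
apply: majorizes_excess => [|k].
  exact: sorted_dual_partition.
apply: leq_trans (rank_pow_gen_le ab gen_ind nil_a nil_b socj charj k).
have red i : exists g : nat -> {poly K}, a ^+ i * b ^+ nth 0%N P i =
     \sum_(t < i) \sum_(s < size (g t))
       (g t)`_s *: (a ^+ t * b ^+ (nth 0%N P i + s)).
  have [g gE] := power_reduction i commAB sP jordanB.
  exists g; apply: subvs_inj; rewrite vsval_pairM !vsval_pairX !val_gen gE linear_sum.
  apply: eq_bigr => t _; rewrite linear_sum -{1}(coefK (g t)) poly_def raddf_sum mulr_sumr.
  apply: eq_bigr => s _ /=; rewrite !linearZ /= rmorphXn /= horner_mx_X.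
  by rewrite -scalerAr -mulrA -exprD !vsval_pairX !val_gen.
have := dim_pow_coker_le ab gen_ind k nil_a nil_b red.
have -> : \dim {: pair_alg A B} = sumn P by rewrite sumP -dimAB dimvf.
move=> dim_le; rewrite -(leq_add2l (\sum_(p <- P) minn p k)); apply: leq_trans dim_le.
rewrite sumnE /excess -big_split /= leq_eqVlt; apply/orP; left; apply/eqP.
by apply: eq_bigr => p _; lia.
Qed.
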